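(* Let $\mathcal{H}$ be a nonzero complex Hilbert space, let $A\in\mathcal{B}(\mathcal{H})$, and let $f$ be a non-negative increasing operator convex function on $[0,\infty)$. Then for all $\alpha\in[0,1]$, $$f(w^2(A))\le\left\|\int_0^1 f\left((1-t)\left(\alpha\left(\frac{|A|+|A^*|}{2}\right)^2+(1-\alpha)|A^*|^2\right)+t\,w^2(A)I\right)dt\right\|\le\left\|f\left(\alpha\left(\frac{|A|+|A^*|}{2}\right)^2+(1-\alpha)|A^*|^2\right)\right\|.$$
   Context: $\mathcal{B}(\mathcal{H})$ is the set of bounded linear operators on $\mathcal{H}$, $A^*$ is the adjoint of $A$, $|A|=(A^*A)^{1/2}$, $I$ is the identity operator, and $\|\cdot\|$ is the operator norm. The numerical radius is $w(A)=\sup\{|\langle Ax,x\rangle| : x\in\mathcal{H},\ \|x\|=1\}$, and $w^2(A)=(w(A))^2$. A real-valued continuous function $f$ on an interval $J$ is operator convex if for all selfadjoint operators $S,T\in\mathcal{B}(\mathcal{H})$ with spectra contained in $J$ one has $f((1-t)S+tT)\le(1-t)f(S)+tf(T)$ for all $t\in[0,1]$, where $f$ of a selfadjoint operator is given by the continuous functional calculus and $\le$ is the usual order on selfadjoint operators. The integral is the integral over $[0,1]$ of a norm-continuous operator-valued function. *)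

(* Defs.v *)
From HB Require Import structures.
From mathcomp Require Import all_boot all_order all_algebra.
From mathcomp Require Import all_classical all_reals all_analysis.
From mathcomp Require Import complex sesquilinear.

Set Implicit Arguments.
Unset Strict Implicit.
Unset Printing Implicit Defensive.

Import Order.TTheory GRing.Theory Num.Theory Num.Def.
Import numFieldNormedType.Exports.
Local Open Scope classical_set_scope.
Local Open Scope ring_scope.
Local Open Scope complex_scope.

(* [{dot H for conjC}] is linear in its first argument and conjugate-linear
   in the second. *)
HB.mixin Record CompleteNormedModule_isHilbert (R : realType) H
    of CompleteNormedModule R[i] H := {
  inner : {dot H for (@conjC R[i])};
  inner_norm : forall x : H, `|x| ^+ 2 = inner x x }.

#[short(type="hilbertType")]
HB.structure Definition Hilbert (R : realType) :=
  {H of CompleteNormedModule_isHilbert R H & CompleteNormedModule R[i] H}.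

(* Operators are plain maps [H -> H]: sums and complex multiples are the
   pointwise ones, the product is [\o] and the identity is [idfun].  The norm
   of a normed module over [R[i]] takes its values in [R[i]], hence the use of
   [complex.Re]. *)
Section Operators.
Context {R : realType} {H : hilbertType R}.
Implicit Types (S T B : H -> H) (f : R -> R).

Definition bounded_operator T :=
  linear T /\ exists M : R[i], forall x, `|T x| <= M * `|x|.

(* On an operator that is not bounded, [opnorm] and [numradius] are not
   meaningful, as [sup] is [0] on a set that has no upper bound. *)
Definition opnorm T : R :=
  sup [set complex.Re `|T x| | x in [set x : H | `|x| <= 1]].

Definition numradius T : R :=
  sup [set complex.Re `|inner (T x) x| | x in [set x : H | `|x| = 1]].

Definition is_adjoint T S := forall x y, inner (T x) y = inner x (S y).

(* A bounded operator has exactly one adjoint, so that the default value [0]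
   is not used. *)
Definition adjoint T : H -> H := xget 0 [set S | is_adjoint T S].

Definition selfadjoint T := bounded_operator T /\ is_adjoint T T.

Definition ople S T := forall x, 0 <= inner ((T - S) x) x.

Definition spectrum T : set R[i] :=
  [set z | ~ exists S, [/\ bounded_operator S,
                           (T - z *: idfun) \o S = idfun &
                           S \o (T - z *: idfun) = idfun]].

Definition oppoly (p : {poly R}) T : H -> H :=
  \sum_(i < size p) (p`_i)%:C *: iter i T.

(* The continuous functional calculus: the extension by continuity of
   [p |-> oppoly p T] from the polynomials to the functions that are
   continuous on the spectrum, with uniform convergence on the spectrum on one
   side and convergence in operator norm on the other.  The spectrum of a
   selfadjoint operator is real, and [f] is determined on it.  [B] exists and
   is unique for [T] selfadjoint and [f] continuous on the spectrum. *)
Definition is_cfc f T B := bounded_operator B /\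
  exists2 p : nat -> {poly R},
    {uniform [set x | spectrum T x%:C], (fun n => horner (p n)) @ \oo --> f} &
    (fun n => opnorm (oppoly (p n) T - B)) @ \oo --> (0 : R).

Definition cfc f T : H -> H := xget 0 [set B | is_cfc f T B].

Definition opabs T : H -> H := cfc Num.sqrt (adjoint T \o T).

Definition operator_convex (J : interval R) f :=
  {within [set` J], continuous f} /\
  forall S T, selfadjoint S -> selfadjoint T ->
    spectrum S `<=` [set x%:C | x in [set` J]] ->
    spectrum T `<=` [set x%:C | x in [set` J]] ->
    forall t : R, 0 <= t <= 1 ->
      ople (cfc f ((1 - t)%:C *: S + t%:C *: T))
           ((1 - t)%:C *: cfc f S + t%:C *: cfc f T).

(* The subdivision [a :: s] of [a, b] has the points [x i], [i <= size s], and
   [xi i] is the tag of [x i, x i.+1]. *)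
Definition is_opint (a b : R) (F : R -> H -> H) B := bounded_operator B /\
  forall e : R, 0 < e -> exists2 d : R, 0 < d &
    forall (s : seq R) (xi : nat -> R),
      let x := nth b (a :: s) in
      itv_partition a b s ->
      (forall i, (i < size s)%N -> x i.+1 - x i < d /\ x i <= xi i <= x i.+1) ->
      opnorm (\sum_(i < size s) (x i.+1 - x i)%:C *: F (xi i) - B) < e.

(* The Riemann integral for the operator norm; it exists and is unique for [F]
   continuous in operator norm on [a, b] with values in bounded operators. *)
Definition opint (a b : R) (F : R -> H -> H) : H -> H :=
  xget 0 [set B | is_opint a b F B].

End Operators.

(* Main.v *)
(** For a unit vector x, the mixed Schwarz inequality
    |<Ax, x>|^2 <= <|A| x, x> <|A^*| x, x> and the arithmetic-geometric mean inequality
    give |<Ax, x>| <= <Mx, x> <= |Mx| with M = (|A| + |A^*|) / 2; also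
    |<Ax, x>| <= |A^* x| = | |A^*| x |.  Hence |<Ax, x>|^2 <= <Xx, x> for the operator X of
    the theorem, and |<Ax, x>|^2 <= <Y_t x, x> for Y_t = (1 - t) X + t w(A)^2 I.  As f is
    convex and increasing, Jensen's inequality gives f(|<Ax, x>|^2) <= <f(Y_t) x, x>;
    integrating over t and taking the supremum over x yields the first inequality, and
    t = 0 yields f(w(A)^2) <= |f(X)|.  With operator convexity this gives
    0 <= f(Y_t) <= (1 - t) f(X) + t f(w(A)^2) <= |f(X)|, hence the second inequality.

    The functional calculus rests on this: if p is a real polynomial, T is selfadjoint and
    m is the infimum of <p(T) x, x> over unit vectors, then p(T) - m is not bounded below;
    factoring p - m over the complex numbers, some T - z is not bounded below, so z is a
    real point of the spectrum with p(z) = m.  Hence p >= 0 on the spectrum implies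
    p(T) >= 0.  The Riemann integral exists because t |-> f(Y_t) is a uniform limit of
    polynomials in t with operator coefficients. *)

Require Import Defs.
From HB Require Import structures.
From mathcomp Require Import all_boot all_order all_algebra.
From mathcomp Require Import all_classical all_reals all_analysis.
From mathcomp Require Import complex.
From mathcomp Require Import sesquilinear ring lra.

Set Implicit Arguments.
Unset Strict Implicit.
Unset Printing Implicit Defensive.

Import Order.TTheory GRing.Theory Num.Theory.
Import numFieldNormedType.Exports.
Local Open Scope classical_set_scope.
Local Open Scope ring_scope.
Local Open Scope complex_scope.

(** * Real and imaginary parts, and a discriminant inequality *)

Section ComplexParts.
Context {R : realType}.
Implicit Types (z w : R[i]) (a : R).

Lemma ReD z w : complex.Re (z + w) = complex.Re z + complex.Re w.
Proof. by case: z w => ? ? []. Qed.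

Lemma ReZ a z : complex.Re (a%:C * z) = a * complex.Re z.
Proof. by case: z => x y /=; rewrite mul0r subr0. Qed.

Lemma ImZ a z : complex.Im (a%:C * z) = a * complex.Im z.
Proof. by case: z => x y /=; rewrite mul0r addr0. Qed.

Lemma Re_iM z : complex.Re ('i%C * z) = - complex.Im z.
Proof. by rewrite mulrC ReiNIm. Qed.

Lemma Re_conjE z : complex.Re (Num.conj z) = complex.Re z.
Proof. by case: z. Qed.

Lemma Im_conjE z : complex.Im (Num.conj z) = - complex.Im z.
Proof. by case: z. Qed.

Lemma RC_inj : injective (fun a : R => a%:C).
Proof. by move=> x y []. Qed.

(** A quadratic in [t] without sign change has nonpositive discriminant; when [c = 0] the expression
    is affine in [t], which forces [b = 0]. *)
Lemma sqr_le_quad (a b c : R) :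
  0 <= c -> (forall t, 0 <= a + 2 * t * b + t ^+ 2 * c) -> b ^+ 2 <= a * c.
Proof.
rewrite le_eqVlt => /orP[/eqP <-|c0] h.
  rewrite mulr0; have [->|b0] := eqVneq b 0; first by rewrite expr0n.
  (* At this [t] the affine expression equals [-1]. *)
  have := h (- (a + 1) / (2 * b)).
  have -> : a + 2 * (- (a + 1) / (2 * b)) * b
            + (- (a + 1) / (2 * b)) ^+ 2 * 0 = -1 by field.
  lra.
have := h (- b / c).
have -> : a + 2 * (- b / c) * b + (- b / c) ^+ 2 * c = a - b ^+ 2 / c.
  by field; rewrite gt_eqF.
by rewrite subr_ge0 ler_pdivrMr.
Qed.

End ComplexParts.

(** * The underlying real Hilbert space *)

Section RealStructure.
Context {R : realType} {H : hilbertType R}.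
Implicit Types (x y z : H) (a : R) (S T D : H -> H).

(* The inner product and the norm of the real Hilbert space underlying [H], whose
   scalars [a : R] act as [a%:C]. *)
Definition rip x y : R := complex.Re (inner x y).
Definition nrm x : R := complex.Re `|x|.

Lemma innerC x y : inner x y = Num.conj (inner y x).
Proof. by rewrite hermC expr0 mul1r. Qed.

Lemma ripC x y : rip x y = rip y x.
Proof. by rewrite /rip innerC Re_conjE. Qed.

Lemma innerZl (c : R[i]) x y : inner (c *: x) y = c * inner x y.
Proof. exact: linearZl_LR. Qed.

Lemma innerZr (c : R[i]) x y : inner x (c *: y) = Num.conj c * inner x y.
Proof. exact: linearZr_LR. Qed.

Lemma innerBl x y z : inner (x - y) z = inner x z - inner y z.
Proof. exact: linearBl. Qed.

Lemma innerBr x y z : inner z (x - y) = inner z x - inner z y.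
Proof. exact: linearBr. Qed.

Lemma ripDl x y z : rip (x + y) z = rip x z + rip y z.
Proof. by rewrite /rip linearDl ReD. Qed.

Lemma ripZl a x y : rip (a%:C *: x) y = a * rip x y.
Proof. by rewrite /rip linearZl_LR ReZ. Qed.

Lemma ripDr x y z : rip x (y + z) = rip x y + rip x z.
Proof. by rewrite ripC ripDl !(ripC x). Qed.

Lemma ripZr a x y : rip x (a%:C *: y) = a * rip x y.
Proof. by rewrite ripC ripZl ripC. Qed.

Lemma ripNl x y : rip (- x) y = - rip x y.
Proof.
have -> : - x = (-1)%:C *: x by rewrite rmorphN1 scaleN1r.
by rewrite ripZl mulN1r.
Qed.

Lemma ripNr x y : rip x (- y) = - rip x y.
Proof. by rewrite ripC ripNl ripC. Qed.

Lemma ripBl x y z : rip (x - y) z = rip x z - rip y z.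
Proof. by rewrite ripDl ripNl. Qed.

Lemma ripBr x y z : rip x (y - z) = rip x y - rip x z.
Proof. by rewrite ripDr ripNr. Qed.

Lemma rip0l y : rip 0 y = 0.
Proof. by rewrite -(subrr y) ripBl subrr. Qed.

Lemma rip0r y : rip y 0 = 0.
Proof. by rewrite ripC rip0l. Qed.

Definition ripE := (ripDl, ripDr, ripBl, ripBr, ripNl, ripNr, ripZl, ripZr).

Lemma nrmE x : `|x| = (nrm x)%:C.
Proof. by rewrite /nrm RRe_real// ger0_real. Qed.

Lemma nrm_ge0 x : 0 <= nrm x.
Proof. by rewrite -ler0c -nrmE. Qed.

Lemma nrm_sqrE x : inner x x = (nrm x ^+ 2)%:C.
Proof. by rewrite -inner_norm nrmE rmorphXn. Qed.

Lemma nrm_sqr x : nrm x ^+ 2 = rip x x.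
Proof. by rewrite /rip nrm_sqrE. Qed.

Lemma nrm0 : nrm 0 = 0.
Proof. by rewrite /nrm normr0. Qed.

Lemma nrm_eq0 x : (nrm x == 0) = (x == 0).
Proof. by rewrite -(normr_eq0 x) nrmE (inj_eq RC_inj). Qed.

Lemma nrmN x : nrm (- x) = nrm x.
Proof. by rewrite /nrm normrN. Qed.

Lemma nrmB x y : nrm (x - y) = nrm (y - x).
Proof. by rewrite /nrm distrC. Qed.

Lemma nrmD x y : nrm (x + y) <= nrm x + nrm y.
Proof. by rewrite -lecR rmorphD/= -!nrmE ler_normD. Qed.

Lemma nrm_sub_trans x y z : nrm (x - z) <= nrm (x - y) + nrm (y - z).
Proof. by rewrite -[x - z](subrKA y); exact: nrmD. Qed.

Lemma nrmZc (c : R[i]) x : nrm (c *: x) = complex.Re `|c| * nrm x.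
Proof.
by rewrite /nrm normrZ nrmE -(RRe_real (normr_real c)) -rmorphM.
Qed.

Lemma nrmZ a x : nrm (a%:C *: x) = `|a| * nrm x.
Proof. by rewrite nrmZc normc_def /= expr0n addr0 sqrtr_sqr. Qed.

(** Multiplying the first vector by ['i] turns the imaginary part of the inner product, up to sign,
    into a real part. *)
Lemma inner_eq_of_rip x y x' y' : rip x y = rip x' y' ->
  rip ('i%C *: x) y = rip ('i%C *: x') y' -> inner x y = inner x' y'.
Proof.
rewrite /rip !linearZl_LR !Re_iM => hR /oppr_inj hI.
by rewrite [LHS]complexE hR hI -complexE.
Qed.

Lemma linD T x y : linear T -> T (x + y) = T x + T y.
Proof. by move=> h; have := h 1 x y; rewrite !scale1r. Qed.

Lemma lin0 T : linear T -> T 0 = 0.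
Proof.
move=> h; apply: (addIr (T 0)).
by rewrite -(linD 0 0 h) addr0 add0r.
Qed.

Lemma linZ T (c : R[i]) x : linear T -> T (c *: x) = c *: T x.
Proof. by move=> h; have := h c x 0; rewrite (lin0 h) !addr0. Qed.

Lemma linB T x y : linear T -> T (x - y) = T x - T y.
Proof. by move=> h; rewrite linD// -scaleN1r linZ// scaleN1r. Qed.

Definition rsym T := forall x y, rip (T x) y = rip x (T y).
Definition rpos T := forall x, 0 <= rip (T x) x.

(** Cauchy-Schwarz for the positive semidefinite form of [T], whose value at [x + t y] is a
    nonnegative quadratic in [t]. *)
Lemma rip_sqr_le T x y : linear T -> rsym T -> rpos T ->
  rip (T x) y ^+ 2 <= rip (T x) x * rip (T y) y.
Proof.
move=> lT sT pT; apply: sqr_le_quad; first exact: pT.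
move=> t; have := pT (x + t%:C *: y).
have e : rip (T y) x = rip (T x) y by rewrite sT ripC.
rewrite linD// linZ// !ripE e; lra.
Qed.

Lemma lin_id : linear (idfun : H -> H). Proof. by []. Qed.
Lemma rsym_id : rsym idfun. Proof. by []. Qed.
Lemma rpos_id : rpos idfun.
Proof. by move=> x; rewrite /= -nrm_sqr sqr_ge0. Qed.

Lemma rip_le x y : `|rip x y| <= nrm x * nrm y.
Proof.
have := rip_sqr_le x y lin_id rsym_id rpos_id.
rewrite /= -!nrm_sqr -exprMn -[in X in X -> _]real_normK ?num_real//.
by rewrite ler_sqr// ?nnegrE ?normr_ge0 ?mulr_ge0 ?nrm_ge0.
Qed.

Lemma bounded_operatorP T : bounded_operator T <->
  linear T /\ exists2 K : R, 0 <= K & forall x, nrm (T x) <= K * nrm x.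
Proof.
split=> -[lT]; last first.
  case=> K K0 h; split=> //; exists K%:C => x.
  by rewrite !nrmE -rmorphM lecR.
(* An inequality in [R[i]] is in particular one between real parts, so the real part of [M] is
   already a bound. *)
case=> M h; split=> //; exists `|complex.Re M|; first exact: normr_ge0.
move=> x; have := h x; rewrite !nrmE lecE => /andP[_ /=].
rewrite mulrC ReZ mulrC => /le_trans; apply.
by rewrite ler_wpM2r ?nrm_ge0// ler_norm.
Qed.

(** Completeness of [H], restated for sequences with the real-valued norm. *)
Lemma hilbert_complete (u : nat -> H) :
  (forall e : R, 0 < e -> exists N, forall m n, (N <= m)%N -> (N <= n)%N ->
     nrm (u m - u n) < e) ->
  exists l, forall e : R, 0 < e -> exists N, forall n, (N <= n)%N ->
     nrm (u n - l) < e.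
Proof.
move=> hu.
have cu : cauchy (u @ \oo).
  (* A positive element of [R[i]] has zero imaginary part. *)
  apply/cauchy_ballP => -[e e'] /=; rewrite ltcE /= => /andP[/eqP -> e0].
  have [N hN] := hu _ e0.
  exists ([set x | exists2 n, (N <= n)%N & x = u n],
          [set x | exists2 n, (N <= n)%N & x = u n]).
    by split; exists N => // n /= Nn; exists n.
  case=> x y /= [[m Nm ->] [n Nn ->]].
  by rewrite -ball_normE /= nrmE ltcE /= eqxx hN.
have hl : u @ \oo --> lim (u @ \oo) by apply: cauchy_cvg.
exists (lim (u @ \oo)) => e e0; have ec : 0 < e%:C by rewrite ltcR.
have [N _ hN] := (cvgrPdist_lt (V := H) _ _).1 hl _ ec.
by exists N => n Nn; have := hN n Nn; rewrite nrmE ltcR nrmB.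
Qed.

End RealStructure.
(** * Riesz representation and adjoints *)

Lemma exists_invS {R : realType} (e : R) : 0 < e ->
  exists N, forall n, (N <= n)%N -> n.+1%:R^-1 < e.
Proof.
move=> e0; have [N _ hN] := near_infty_natSinv_lt (PosNum e0).
by exists N => n Nn; exact: hN.
Qed.

Lemma le0_of_addgt0 {R : realType} (a : R) : (forall e, 0 < e -> - e <= a) -> 0 <= a.
Proof. by move=> h; apply/ler_addgt0Pl => e /h; lra. Qed.

Section Adjoints.
Context {R : realType} {H : hilbertType R}.
Implicit Types (x y z : H) (a : R) (S T D : H -> H).

(* Minimise [x |-> <D x, x> - 2 phi x]; by the parallelogram law a minimising
   sequence is Cauchy. *)
Lemma coercive_solve D (phi : H -> R) (K c M : R) : linear D -> rsym D ->
  (forall x, nrm (D x) <= K * nrm x) -> 0 < c ->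
  (forall x, c * nrm x ^+ 2 <= rip (D x) x) ->
  (forall x y, phi (x + y) = phi x + phi y) ->
  (forall a x, phi (a%:C *: x) = a * phi x) ->
  (forall x, phi x <= M * nrm x) ->
  exists x, forall h, rip (D x) h = phi h.
Proof.
move=> lD sD bD c0 cD phiD phiZ phiM.
pose J x := rip (D x) x - 2 * phi x.
have Jlb x : - (M ^+ 2 / c) <= J x.
  (* Completing the square in [c * nrm x ^+ 2 - 2 * M * nrm x] bounds [J] from below. *)
  have h0 : 0 <= (c * nrm x - M) ^+ 2 / c by rewrite divr_ge0 ?sqr_ge0// ltW.
  have e : (c * nrm x - M) ^+ 2 / c = c * nrm x ^+ 2 - 2 * (M * nrm x) + M ^+ 2 / c.
    by field; rewrite gt_eqF.
  by have := phiM x; have := cD x; rewrite /J; lra.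
have hJ : has_inf (range J).
  by split; [exists (J 0), 0 | exists (- (M ^+ 2 / c)) => _ [x _ <-]].
pose m := inf (range J).
have mJ x : m <= J x by apply: (inf_lbound hJ.2); exists x.
have /choice[u hu] : forall n : nat, exists x, J x < m + n.+1%:R^-1.
  move=> n; have n0 : 0 < n.+1%:R^-1 :> R by rewrite invr_gt0.
  by have [_ [x _ <-] hx] := inf_adherent n0 hJ; exists x.
have par x y : rip (D (x - y)) (x - y)
    = 2 * J x + 2 * J y - 4 * J ((2^-1)%:C *: (x + y)).
  by rewrite /J linB// linZ// linD// phiZ phiD !ripE; field.
have [l hl] : exists l, forall e : R, 0 < e -> exists N, forall n, (N <= n)%N ->
     nrm (u n - l) < e.
  apply: hilbert_complete => e e0.
  have d0 : 0 < c * e ^+ 2 / 4 by rewrite divr_gt0// mulr_gt0// exprn_gt0.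
  have [N hN] := exists_invS d0; exists N => p q Np Nq.
  rewrite -ltr_sqr ?nnegrE ?nrm_ge0 ?(ltW e0)// -(ltr_pM2l c0).
  apply: le_lt_trans (cD _) _; rewrite par.
  have := hN _ Np; have := hN _ Nq; have := hu p; have := hu q.
  have := mJ ((2^-1)%:C *: (u p + u q)).
  move: (p.+1%:R^-1 : R) (q.+1%:R^-1 : R) => a b; lra.
exists l => h; apply/eqP; rewrite -subr_eq0 -sqrf_eq0 eq_le sqr_ge0 andbT.
have dh : 0 <= rip (D h) h.
  by apply: le_trans (cD h); rewrite mulr_ge0 ?sqr_ge0 ?ltW.
(* First variation at the minimiser: [J (l + t h) - J l] is a nonnegative quadratic in [t] without
   constant term, so its linear coefficient vanishes. *)
rewrite -[leRHS](mul0r (rip (D h) h)); apply: sqr_le_quad => // t.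
rewrite add0r; apply: le0_of_addgt0 => e e0.
(* [k] bounds the effect on the linear term of replacing [l] by [u n], and the [+ 1] keeps it
   positive. Half of [e] pays for this, the other half for [J (u n)] exceeding [m]. *)
pose k := 2 * `|t| * `|K| * nrm h + 1.
have k0 : 0 < k by rewrite ltr_wpDl// !mulr_ge0 ?nrm_ge0.
have e20 : 0 < e / 2 by lra.
have ek0 : 0 < e / 2 / k by rewrite divr_gt0.
have [N1 h1] := hl _ ek0; have [N2 h2] := exists_invS e20.
pose n := maxn N1 N2.
have := h1 n (leq_maxl _ _); have := h2 n (leq_maxr _ _); have := hu n.
have := mJ (u n + t%:C *: h).
have e1 : rip (D h) (u n) = rip (D (u n)) h by rewrite sD ripC.
rewrite /J linD// linZ// phiD phiZ !ripE e1.
move: (n.+1%:R^-1 : R) => b i1 i2 i3 i4.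
have i5 : `|2 * t * rip (D (u n - l)) h| <= e / 2.
  rewrite !normrM (ger0_norm (ler0n _ 2)).
  apply: (@le_trans _ _ (k * nrm (u n - l))); last first.
    by rewrite mulrC -ler_pdivlMr// ltW.
  have /le_trans -> // : 2 * `|t| * `|rip (D (u n - l)) h| <=
      2 * `|t| * (`|K| * nrm (u n - l) * nrm h).
    rewrite ler_wpM2l ?mulr_ge0//; apply: le_trans (rip_le _ _) _.
    rewrite ler_wpM2r ?nrm_ge0//; apply: le_trans (bD _) _.
    by rewrite ler_wpM2r ?nrm_ge0// ler_norm.
  by have := nrm_ge0 (u n - l); rewrite /k; lra.
move: i5; rewrite ler_norml linB// ripBl => /andP[]; lra.
Qed.

Lemma inner_inj x y : (forall z, inner z x = inner z y) -> x = y.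
Proof.
move=> h; apply/eqP; rewrite -subr_eq0 -nrm_eq0 -sqrf_eq0 nrm_sqr ripBr.
by rewrite /rip h subrr.
Qed.

Lemma is_adjoint_sym T S : is_adjoint T S -> is_adjoint S T.
Proof. by move=> h x y; rewrite innerC -h -innerC. Qed.

Lemma is_adjoint_rip T S : linear T -> (forall x y, rip (T x) y = rip x (S y)) ->
  is_adjoint T S.
Proof. by move=> lT h x y; apply: inner_eq_of_rip; rewrite // -linZ. Qed.

Lemma is_adjoint_uniq T S S' : is_adjoint T S -> is_adjoint T S' -> S = S'.
Proof. by move=> h h'; apply/funext => y; apply: inner_inj => z; rewrite -h h'. Qed.

(** Riesz representation: [coercive_solve] with [D] the identity represents the functional sending
    [x] to [rip (T x) y]. *)
Lemma adjointP T : bounded_operator T -> is_adjoint T (adjoint T).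
Proof.
move=> /bounded_operatorP[lT [K K0 hK]]; apply: (@xgetPex _ 0 (is_adjoint T)).
suff /choice[S hS] : forall y, exists z, forall x, rip z x = rip (T x) y.
  by exists S; apply: is_adjoint_rip => // x y; rewrite -hS ripC.
move=> y.
apply: (@coercive_solve idfun (fun x => rip (T x) y) 1 1 (K * nrm y)) => //.
- by move=> x; rewrite mul1r.
- by move=> x; rewrite mul1r nrm_sqr.
- by move=> x z; rewrite linD// ripDl.
- by move=> a x; rewrite linZ// ripZl.
- move=> x; apply: le_trans (ler_norm _) _; apply: le_trans (rip_le _ _) _.
  by rewrite mulrAC ler_wpM2r ?nrm_ge0.
Qed.

Lemma adjoint_bounded T : bounded_operator T -> bounded_operator (adjoint T).
Proof.
move=> bT; have aT := adjointP bT; have [lT [K K0 hK]] := (bounded_operatorP T).1 bT.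
apply/bounded_operatorP; split.
  move=> a x y; apply: inner_inj => z.
  by rewrite -aT !linearDr !linearZr_LR /= !aT.
exists K => // x; have [->|x0] := eqVneq (adjoint T x) 0.
  by rewrite nrm0 mulr_ge0 ?nrm_ge0.
have n0 : 0 < nrm (adjoint T x) by rewrite lt_neqAle nrm_ge0 eq_sym nrm_eq0 x0.
rewrite -(ler_pM2l n0) -expr2 nrm_sqr {1}/rip -aT -/(rip _ _).
apply: le_trans (ler_norm _) _; apply: le_trans (rip_le _ _) _.
by rewrite mulrCA mulrA ler_wpM2r ?nrm_ge0.
Qed.

Lemma adjointK T : bounded_operator T -> adjoint (adjoint T) = T.
Proof.
move=> bT; apply: (is_adjoint_uniq (T := adjoint T)).
  exact/adjointP/adjoint_bounded.
exact/is_adjoint_sym/adjointP.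
Qed.

Lemma selfadjointP T : selfadjoint T <-> bounded_operator T /\ rsym T.
Proof.
split=> -[bT h]; split=> //; first by move=> x y; rewrite /rip h.
by apply: is_adjoint_rip => //; case: bT.
Qed.

End Adjoints.
(** * Bounded operators *)

Section Bounded.
Context {R : realType} {H : hilbertType R}.
Implicit Types (x y z : H) (a c : R) (S T D : H -> H).

Lemma opD S T x : (S + T) x = S x + T x. Proof. by []. Qed.
Lemma opN T x : (- T) x = - T x. Proof. by []. Qed.
Lemma opZ (z : R[i]) T x : (z *: T) x = z *: T x. Proof. by []. Qed.
Lemma opI x : (idfun : H -> H) x = x. Proof. by []. Qed.
Lemma opC S T x : (S \o T) x = S (T x). Proof. by []. Qed.
Definition opE := (opD, opN, opZ, opC, opI).

Lemma bounded_lin T : bounded_operator T -> linear T.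
Proof. by case. Qed.

Lemma bounded_id : bounded_operator (idfun : H -> H).
Proof. by apply/bounded_operatorP; split=> //; exists 1 => // x; rewrite mul1r. Qed.

Lemma bounded_0 : bounded_operator (0 : H -> H).
Proof.
apply/bounded_operatorP; split; first by move=> a x y; rewrite /= scaler0 addr0.
by exists 0 => // x; rewrite mul0r [X in nrm X](_ : _ = 0)// nrm0.
Qed.

Lemma bounded_comp S T : bounded_operator S -> bounded_operator T ->
  bounded_operator (S \o T).
Proof.
move=> /bounded_operatorP[lS [K K0 hK]] /bounded_operatorP[lT [L L0 hL]].
apply/bounded_operatorP; split.
  by move=> a x y; rewrite !opE lT lS.
exists (K * L); first exact: mulr_ge0.
by move=> x; apply: le_trans (hK _) _; rewrite -mulrA ler_wpM2l.
Qed.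

Lemma bounded_D S T : bounded_operator S -> bounded_operator T ->
  bounded_operator (S + T).
Proof.
move=> /bounded_operatorP[lS [K K0 hK]] /bounded_operatorP[lT [L L0 hL]].
apply/bounded_operatorP; split.
  by move=> a x y; rewrite !opE lT lS scalerDr addrACA.
exists (K + L); first exact: addr_ge0.
by move=> x; rewrite opE mulrDl; apply: le_trans (nrmD _ _) _; exact: lerD.
Qed.

Lemma bounded_Z (a : R[i]) T : bounded_operator T -> bounded_operator (a *: T).
Proof.
move=> /bounded_operatorP[lT [L L0 hL]].
have a0 : 0 <= complex.Re `|a|.
  by rewrite -ler0c RRe_real ?normr_real// normr_ge0.
apply/bounded_operatorP; split.
  by move=> b x y; rewrite !opE lT scalerDr !scalerA mulrC.
exists (complex.Re `|a| * L); first exact: mulr_ge0.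
by move=> x; rewrite opE nrmZc -mulrA ler_wpM2l.
Qed.

Lemma bounded_N T : bounded_operator T -> bounded_operator (- T).
Proof. by rewrite -scaleN1r; exact: bounded_Z. Qed.

Lemma bounded_B S T : bounded_operator S -> bounded_operator T ->
  bounded_operator (S - T).
Proof. by move=> bS bT; apply: bounded_D => //; exact: bounded_N. Qed.

Lemma bounded_sub_id T (z : R[i]) : bounded_operator T -> bounded_operator (T - z *: idfun).
Proof. by move=> bT; apply: bounded_B => //; apply: bounded_Z; exact: bounded_id. Qed.

Lemma bounded_sum (I : Type) (r : seq I) (F : I -> H -> H) :
  (forall i, bounded_operator (F i)) -> bounded_operator (\sum_(i <- r) F i).
Proof.
move=> hF; elim: r => [|i r IH]; first by rewrite big_nil; exact: bounded_0.
by rewrite big_cons; exact: bounded_D.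
Qed.

Lemma nrm_gt0 x : x != 0 -> 0 < nrm x.
Proof. by rewrite -nrm_eq0 lt_neqAle nrm_ge0 eq_sym => ->. Qed.

(** Cauchy-Schwarz for the form of [D], at the vectors [x] and [D x], followed by cancelling
    [nrm (D x) ^+ 2]. *)
Lemma rpos_nrm_sqr D c x : linear D -> rsym D -> rpos D ->
  (forall y, rip (D y) y <= c * nrm y ^+ 2) ->
  nrm (D x) ^+ 2 <= c * rip (D x) x.
Proof.
move=> lD sD pD hc; have [->|x0] := eqVneq (D x) 0.
  by rewrite nrm0 rip0l mulr0 expr0n.
rewrite -(ler_pM2r (exprn_gt0 2 (nrm_gt0 x0))).
have := rip_sqr_le x (D x) lD sD pD; rewrite -nrm_sqr expr2 => /le_trans; apply.
by rewrite mulrAC mulrC ler_wpM2r.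
Qed.

Lemma rpos_nrm_le D c x : linear D -> rsym D -> rpos D ->
  (forall y, rip (D y) y <= c * nrm y ^+ 2) -> 0 <= c ->
  nrm (D x) <= c * nrm x.
Proof.
move=> lD sD pD hc c0; rewrite -ler_sqr ?nnegrE ?mulr_ge0 ?nrm_ge0//.
apply: le_trans (rpos_nrm_sqr _ lD sD pD hc) _.
by rewrite exprMn expr2 -mulrA ler_wpM2l.
Qed.

End Bounded.

(** * The spectrum of a selfadjoint operator *)

Section Spectrum.
Context {R : realType} {H : hilbertType R}.
Implicit Types (x y : H) (a c : R) (S T D : H -> H) (z : R[i]).

(** For selfadjoint [T], the two lemmas [not_spectrum_bbelow] and [bbelow_not_spectrum] make this
    property of [T - z] equivalent to [z] lying outside the spectrum. *)
Definition bbelow T := exists2 c : R, 0 < c & forall x, c * nrm x <= nrm (T x).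

Lemma bbelow_coercive T c : 0 < c ->
  (forall x, c * nrm x ^+ 2 <= `|rip (T x) x|) -> bbelow T.
Proof.
move=> c0 hc; exists c => // x; have [->|x0] := eqVneq x 0.
  by rewrite nrm0 mulr0 nrm_ge0.
rewrite -(ler_pM2r (nrm_gt0 x0)) -mulrA -expr2.
exact: le_trans (rip_le _ _).
Qed.

Lemma not_spectrum_bbelow T z : ~ spectrum T z -> bbelow (T - z *: idfun).
Proof.
move=> /contrapT[S [/bounded_operatorP[lS [K K0 hK]] _ hS]].
exists (K + 1)^-1; first by rewrite invr_gt0 ltr_wpDl.
move=> x; rewrite mulrC ler_pdivrMr ?ltr_wpDl//.
have {1}-> : x = S ((T - z *: idfun) x).
  by rewrite -[RHS]/((S \o (T - z *: idfun)) x) hS.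
by apply: le_trans (hK _) _; rewrite mulrC ler_wpM2l ?nrm_ge0// lerDl.
Qed.

(** With [E = T - z] and its adjoint [F], the operator [F \o E] is coercive, hence onto. As [E] and
    [F] commute, [E] is onto too; it is injective because it is bounded below. *)
Lemma bbelow_not_spectrum T z : selfadjoint T -> bbelow (T - z *: idfun) ->
  ~ spectrum T z.
Proof.
move=> [bT aT] [c c0 hc]; apply.
pose E := T - z *: idfun; rewrite -/E in hc; pose F := T - Num.conj z *: idfun.
have bE : bounded_operator E by exact: bounded_sub_id.
have bF : bounded_operator F by exact: bounded_sub_id.
have lE := bounded_lin bE; have lF := bounded_lin bF; have lT := bounded_lin bT.
have aF x y : rip (F x) y = rip x (E y).
  rewrite /rip /E /F !opE innerBl innerBr innerZl innerZr.
  by rewrite aT.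
have EF x : E (F x) = F (E x).
  rewrite /E /F !opE !(linB _ _ lT) !(linZ _ _ lT). rewrite !scalerBr !scalerA.
  by rewrite (mulrC z) !opprD !opprK !addrA; congr (_ + _); rewrite addrAC.
have [lD [K K0 hK]] := (bounded_operatorP _).1 (bounded_comp bF bE).
have Esurj y : exists x, E x = y.
  have [x hx] : exists x, forall h, rip ((F \o E) x) h = rip y h.
    apply: (@coercive_solve _ _ (F \o E) (rip y) K (c ^+ 2) (nrm y)) => //.
    - by move=> u v; rewrite /= aF ripC -aF ripC.
    - exact: exprn_gt0.
    - move=> u; rewrite /= aF -nrm_sqr -exprMn ler_sqr ?nnegrE ?nrm_ge0//.
      by rewrite mulr_ge0 ?nrm_ge0// ltW.
    - by move=> u v; rewrite ripDr.
    - by move=> a u; rewrite ripZr.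
    - by move=> u; exact: le_trans (ler_norm _) (rip_le _ _).
  exists (F x); rewrite EF; apply/eqP; rewrite -subr_eq0 -nrm_eq0 -sqrf_eq0.
  by rewrite nrm_sqr ripBl -hx subrr.
have Einj x y : E x = E y -> x = y.
  move=> e; apply/eqP; rewrite -subr_eq0 -nrm_eq0 eq_le nrm_ge0 andbT.
  by rewrite -(ler_pM2l c0) mulr0; apply: le_trans (hc _) _; rewrite linB// e subrr nrm0.
have [S hS] := choice Esurj.
exists S; split; last 2 first.
- by apply/funext => x; exact: hS.
- by apply/funext => x; apply: Einj; exact: hS.
apply/bounded_operatorP; split.
  by move=> a x y; apply: Einj; rewrite hS (linD _ _ lE) (linZ _ _ lE) !hS.
exists c^-1; first by rewrite invr_ge0 ltW.
by move=> x; rewrite mulrC ler_pdivlMr// mulrC; apply: le_trans (hc _) _; rewrite hS.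
Qed.

(** The imaginary part of the form of [T - z] at [x] is [- Im z] times the squared norm, so [T - z]
    is bounded below by [|Im z|]. *)
Lemma spectrum_real T z : selfadjoint T -> spectrum T z -> z = (complex.Re z)%:C.
Proof.
move=> sT; have [bT aT] := sT; apply: contraPP => zr.
apply: bbelow_not_spectrum => //.
have Iz : complex.Im z != 0.
  by apply/eqP => h; apply: zr; case: z h => a b /= ->.
have rI (u v : H) : rip u ('i%C *: v) = complex.Im (inner u v).
  rewrite /rip innerZr.
  by case: (inner u v) => a b /=; rewrite mul0r sub0r mulN1r opprK.
exists `|complex.Im z|; first by rewrite normr_gt0.
move=> x; have [->|x0] := eqVneq x 0; first by rewrite nrm0 mulr0 nrm_ge0.
rewrite -(ler_pM2r (nrm_gt0 x0)).
have e : nrm x = nrm ('i%C *: x) :> R.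
  by rewrite nrmZc normc_def /= expr0n expr1n add0r sqrtr1 mul1r.
rewrite [X in _ <= _ * X]e; apply: le_trans (rip_le _ _).
rewrite !opE ripBl !rI.
have -> : complex.Im (inner (T x) x) = 0.
  have := congr1 (@complex.Im R) (etrans (aT x x) (innerC x (T x))).
  by rewrite Im_conjE; lra.
rewrite innerZl nrm_sqrE [z * _]mulrC ImZ sub0r normrN normrM.
by rewrite (ger0_norm (sqr_ge0 _)); lra.
Qed.

(** For [a < m] the form of [T - a] is coercive with constant [m - a]. *)
Lemma spectrum_ge T m a : selfadjoint T ->
  (forall x, m * nrm x ^+ 2 <= rip (T x) x) -> spectrum T a%:C -> m <= a.
Proof.
move=> sT hm; rewrite leNgt; apply: contraPN => am.
apply: bbelow_not_spectrum => //; apply: (@bbelow_coercive _ (m - a)).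
  by rewrite subr_gt0.
move=> x; rewrite !opE ripBl ripZl -nrm_sqr.
by apply: le_trans (ler_norm _); have := hm x; lra.
Qed.

Lemma spectrum_le T m a : selfadjoint T ->
  (forall x, rip (T x) x <= m * nrm x ^+ 2) -> spectrum T a%:C -> a <= m.
Proof.
move=> sT hm; rewrite leNgt; apply: contraPN => am.
apply: bbelow_not_spectrum => //; apply: (@bbelow_coercive _ (a - m)).
  by rewrite subr_gt0.
move=> x; rewrite !opE ripBl ripZl -nrm_sqr distrC.
by apply: le_trans (ler_norm _); have := hm x; lra.
Qed.

(** The infimum [m] of the form on unit vectors is an approximate eigenvalue: [S - m] is positive,
    so the squared norm of its value at [x] is at most a constant times its form, which comes
    arbitrarily close to zero. *)
Lemma inf_not_bbelow S x0 : selfadjoint S -> x0 != 0 ->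
  exists2 m : R, (forall x, m * nrm x ^+ 2 <= rip (S x) x) &
    ~ bbelow (S - m%:C *: idfun).
Proof.
move=> /selfadjointP[bS sS] x00.
have lS := bounded_lin bS; have [_ [K K0 hK]] := (bounded_operatorP S).1 bS.
pose N := [set rip (S x) x | x in [set x | nrm x = 1]].
have unit x : x != 0 -> nrm ((nrm x)^-1%:C *: x) = 1.
  move=> x1; rewrite nrmZ ger0_norm ?invr_ge0 ?nrm_ge0// mulVf//.
  by rewrite nrm_eq0.
have NK x : `|rip (S x) x| <= K * nrm x ^+ 2.
  apply: le_trans (rip_le _ _) _; rewrite expr2 mulrA.
  by rewrite ler_wpM2r ?nrm_ge0.
have iN : has_inf N.
  split; first by exists (rip (S ((nrm x0)^-1%:C *: x0)) ((nrm x0)^-1%:C *: x0)),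
    ((nrm x0)^-1%:C *: x0) => //; exact: unit.
  exists (- K) => _ [x /= x1 <-].
  by have := NK x; rewrite x1 expr1n mulr1 ler_norml => /andP[].
have mle x : inf N * nrm x ^+ 2 <= rip (S x) x.
  have [->|x1] := eqVneq x 0; first by rewrite nrm0 expr0n mulr0 rip0r.
  have := inf_lbound iN.2 (ex_intro2 _ _ _ (unit x x1) erefl).
  rewrite (linZ _ _ lS) ripZl ripZr mulrA -expr2 exprVn mulrC.
  by rewrite ler_pdivlMr// exprn_gt0// nrm_gt0.
exists (inf N) => //; case=> c c0 hc.
pose D := S - (inf N)%:C *: idfun.
have DE x : rip (D x) x = rip (S x) x - inf N * nrm x ^+ 2.
  by rewrite /D !opE ripBl ripZl -nrm_sqr.
(* An upper bound for the form of [D]; the [+ 1] makes it positive. *)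
pose L := K + `|inf N| + 1.
have L0 : 0 < L by rewrite ltr_wpDl// addr_ge0.
have DL x : nrm (D x) ^+ 2 <= L * rip (D x) x.
  apply: rpos_nrm_sqr.
  - exact/bounded_lin/bounded_sub_id.
  - by move=> u v; rewrite /D !opE !ripE sS.
  - by move=> u; rewrite DE subr_ge0.
  move=> u; rewrite DE.
  have h1 := le_trans (ler_norm _) (NK u).
  have h2 : - (inf N) * nrm u ^+ 2 <= `|inf N| * nrm u ^+ 2.
    by rewrite ler_wpM2r ?sqr_ge0// -normrN ler_norm.
  by have := sqr_ge0 (nrm u); rewrite /L; lra.
(* A unit vector whose [D]-form is below [c ^+ 2 / L] would have [nrm (D x) < c]. *)
have d0 : 0 < c ^+ 2 / L by rewrite divr_gt0// exprn_gt0.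
have [_ [x /= x1 <-]] := inf_adherent d0 iN; apply/negP; rewrite -leNgt.
have := DL x; rewrite DE x1 expr1n mulr1 -ler_pdivrMl// lerBrDl => h; apply: le_trans h.
rewrite lerD2l mulrC ler_wpM2l ?invr_ge0 ?(ltW L0)//.
rewrite ler_sqr ?nnegrE ?nrm_ge0 ?(ltW c0)//.
by apply: le_trans (hc x); rewrite x1 mulr1.
Qed.

End Spectrum.
(** * Polynomials of an operator *)

Section PolynomialCalculus.
Context {R : realType} {H : hilbertType R}.
Implicit Types (x y : H) (a c : R) (S T D : H -> H) (z : R[i]).
Implicit Types (p q : {poly R}) (g h : {poly R[i]}).

(** The complex counterpart of [oppoly]: a real polynomial splits into linear factors only over
    [R[i]]. *)
Definition cpoly g T : H -> H := fun x => \sum_(i < size g) g`_i *: iter i T x.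

(** Padding with zero coefficients gives polynomials of different sizes a common summation range. *)
Lemma cpolyE g T n x : (size g <= n)%N ->
  cpoly g T x = \sum_(i < n) g`_i *: iter i T x.
Proof.
move=> gn; rewrite /cpoly -!(big_mkord xpredT (fun i => g`_i *: iter i T x)).
rewrite [RHS](big_cat_nat (leq0n _) gn) /=.
rewrite [X in _ + X]big_nat_cond [X in _ + X]big1 ?addr0// => i.
by rewrite andbT => /andP[gi _]; rewrite nth_default// scale0r.
Qed.

Lemma cpolyD g h T x : cpoly (g + h) T x = cpoly g T x + cpoly h T x.
Proof.
rewrite (@cpolyE _ _ (maxn (size g) (size h))) ?size_polyD//.
rewrite (@cpolyE g _ _ _ (leq_maxl _ (size h))).
rewrite (@cpolyE h _ _ _ (leq_maxr (size g) _)) -big_split /=.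
by apply: eq_bigr => i _; rewrite coefD scalerDl.
Qed.

Lemma cpolyZ z g T x : cpoly (z *: g) T x = z *: cpoly g T x.
Proof.
rewrite (@cpolyE _ _ (size g)) ?size_scale_leq// /cpoly scaler_sumr.
by apply: eq_bigr => i _; rewrite coefZ scalerA.
Qed.

Lemma cpolyC z T x : cpoly z%:P T x = z *: x.
Proof.
rewrite (@cpolyE _ _ (1)) ?size_polyC_leq1// big_ord_recl big_ord0 addr0.
by rewrite coefC.
Qed.

Lemma cpolyMX g T x : cpoly (g * 'X) T x = cpoly g T (T x).
Proof.
rewrite (@cpolyE _ _ ((size g).+1)); last first.
  by apply: leq_trans (size_polyMleq _ _) _; rewrite size_polyX addn2.
rewrite big_ord_recl coefMX /= scale0r add0r.
by apply: eq_bigr => i _; rewrite coefMX /= -iterSr.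
Qed.

Lemma cpolyX T x : cpoly 'X T x = T x.
Proof. by rewrite -[X in cpoly X]mul1r cpolyMX cpolyC scale1r. Qed.

Lemma cpoly_comm g T x : linear T -> cpoly g T (T x) = T (cpoly g T x).
Proof.
move=> lT; elim/poly_ind: g x => [|g z IH] x.
  by rewrite /cpoly size_poly0 !big_ord0 lin0.
by rewrite !cpolyD !cpolyMX !cpolyC IH (linD _ _ lT) (linZ _ _ lT).
Qed.

Lemma cpolyM g h T x : linear T -> cpoly (g * h) T x = cpoly g T (cpoly h T x).
Proof.
move=> lT; elim/poly_ind: g x => [|g z IH] x.
  by rewrite mul0r /cpoly size_poly0 !big_ord0.
rewrite mulrDl mul_polyC !cpolyD cpolyZ cpolyC mulrAC !cpolyMX IH.
by rewrite cpoly_comm.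
Qed.

(** Lower bounds multiply under composition, so the linear factors can be treated one at a time. *)
Lemma cpoly_bbelow T z (s : seq R[i]) : linear T -> z != 0 ->
  (forall w, w \in s -> bbelow (T - w *: idfun)) ->
  bbelow (cpoly (z *: \prod_(w <- s) ('X - w%:P)) T).
Proof.
move=> lT z0 hs.
have zpos : 0 < complex.Re `|z|.
  by rewrite -ltcR RRe_real ?normr_real// normr_gt0.
suff [c c0 hc] : bbelow (cpoly (\prod_(w <- s) ('X - w%:P)) T).
  exists (complex.Re `|z| * c); first exact: mulr_gt0.
  by move=> x; rewrite cpolyZ nrmZc -mulrA ler_pM2l.
elim: s hs => [|w s IH] hs.
  by exists 1 => // x; rewrite big_nil cpolyC scale1r mul1r.
have /IH [c c0 hc] : forall u, u \in s -> bbelow (T - u *: idfun).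
  by move=> u us; apply: hs; rewrite inE us orbT.
have [d d0 hd] := hs w (mem_head _ _).
exists (d * c); first exact: mulr_gt0.
move=> x; rewrite big_cons cpolyM//.
have -> y : cpoly ('X - w%:P) T y = (T - w *: idfun) y.
  by rewrite cpolyD cpolyX -polyCN cpolyC scaleNr.
by rewrite -mulrA; apply: le_trans (hd _); rewrite ler_wpM2l// ltW.
Qed.

Lemma oppoly_cpoly p T x : oppoly p T x = cpoly (map_poly (real_complex R) p) T x.
Proof.
rewrite /oppoly /cpoly size_map_poly fct_sumE; apply: eq_bigr => i _.
by rewrite coef_map.
Qed.

Lemma oppolyD p q T x : oppoly (p + q) T x = oppoly p T x + oppoly q T x.
Proof. by rewrite !oppoly_cpoly rmorphD cpolyD. Qed.

Lemma oppolyZ a q T x : oppoly (a *: q) T x = a%:C *: oppoly q T x.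
Proof. by rewrite !oppoly_cpoly map_polyZ cpolyZ. Qed.

Lemma oppolyN p T x : oppoly (- p) T x = - oppoly p T x.
Proof. by rewrite -scaleN1r oppolyZ rmorphN1 scaleN1r. Qed.

Lemma oppolyC a T x : oppoly a%:P T x = a%:C *: x.
Proof. by rewrite !oppoly_cpoly map_polyC cpolyC. Qed.

Lemma oppolyX T x : oppoly 'X T x = T x.
Proof. by rewrite !oppoly_cpoly map_polyX cpolyX. Qed.

Lemma oppolyMX p T x : oppoly (p * 'X) T x = oppoly p T (T x).
Proof. by rewrite !oppoly_cpoly rmorphM/= map_polyX cpolyMX. Qed.

Lemma oppolyM p q T x : linear T -> oppoly (p * q) T x = oppoly p T (oppoly q T x).
Proof. by move=> lT; rewrite !oppoly_cpoly rmorphM cpolyM. Qed.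

Definition oppolyE := (oppolyD, oppolyN, oppolyMX, oppolyC, oppolyX, oppolyZ).

Lemma oppoly_comm p T x : linear T -> oppoly p T (T x) = T (oppoly p T x).
Proof. by move=> lT; rewrite !oppoly_cpoly cpoly_comm. Qed.

Lemma oppoly_bounded p T : bounded_operator T -> bounded_operator (oppoly p T).
Proof.
move=> bT; apply: bounded_sum => i; apply: bounded_Z.
elim: (i : nat) => [|n IH] /=; first exact: bounded_id.
exact: bounded_comp bT IH.
Qed.

Lemma oppoly_selfadjoint p T : selfadjoint T -> selfadjoint (oppoly p T).
Proof.
move=> /selfadjointP[bT sT]; apply/selfadjointP; split; first exact: oppoly_bounded.
have lT := bounded_lin bT.
elim/poly_ind: p => [|p c IH] x y.
  by rewrite -polyC0 !oppolyC !scale0r rip0l rip0r.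
rewrite !oppolyD !oppolyMX !oppolyC !ripE; congr (_ + _).
by rewrite IH oppoly_comm// sT.
Qed.

(** If no complex root of [p] lay in the spectrum, every linear factor would be bounded below, and
    so would their product. A root in the spectrum is real by [spectrum_real]. *)
Lemma root_in_spectrum p T : selfadjoint T -> p != 0 -> ~ bbelow (oppoly p T) ->
  exists2 a, spectrum T a%:C & p.[a] = 0.
Proof.
move=> sT p0; apply: contra_notP => hn.
have lT := bounded_lin sT.1.
pose g := map_poly (real_complex R) p.
have [s gE] := closed_field_poly_normal g.
have g0 : lead_coef g != 0 by rewrite lead_coef_eq0 map_poly_eq0.
have [c c0 hc] : bbelow (cpoly g T).
  rewrite gE; apply: cpoly_bbelow => // w ws.
  apply: not_spectrum_bbelow => hw; apply: hn.
  have wE := spectrum_real sT hw; exists (complex.Re w); first by rewrite -wE.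
  have : root g w by rewrite gE rootZ// root_prod_XsubC.
  by rewrite wE /root horner_map /= => /eqP /RC_inj.
by exists c => // x; rewrite oppoly_cpoly.
Qed.

Lemma spectrum_nonempty T x : selfadjoint T -> x != 0 ->
  exists a, spectrum T a%:C.
Proof.
move=> sT x0; have [m _ hm] := inf_not_bbelow sT x0.
have [|a ha _] := @root_in_spectrum ('X - m%:P) T sT
  (negbT (polyXsubC_eq0 m)); last by exists a.
apply: contra_not hm => -[c c0 hc]; exists c => // y.
by have := hc y; rewrite !oppolyE !opE.
Qed.

Lemma oppoly_ge0 p T : selfadjoint T ->
  (forall a, spectrum T a%:C -> 0 <= p.[a]) -> rpos (oppoly p T).
Proof.
move=> sT hp x; have [->|x0] := eqVneq x 0; first by rewrite rip0r.
have [m mle hm] := inf_not_bbelow (oppoly_selfadjoint p sT) x0.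
apply: le_trans (mle x); rewrite mulr_ge0 ?sqr_ge0//.
(* If [p] is the constant [m], it has no distinguished root, and any point of the nonempty spectrum
   gives the sign of [m]. *)
have [pm|pm] := eqVneq (p - m%:P) 0.
  have [a ha] := spectrum_nonempty sT x0; have := hp a ha.
  by move/eqP : pm; rewrite subr_eq0 => /eqP ->; rewrite hornerC.
have [|a ha] := @root_in_spectrum (p - m%:P) T sT pm.
  apply: contra_not hm => -[c c0 hc]; exists c => // y.
  by have := hc y; rewrite !oppolyE !opE.
by rewrite !hornerE => /eqP; rewrite subr_eq0 => /eqP <-; exact: hp.
Qed.

(** Positivity of [oppoly] at the polynomial [c ^+ 2 - p ^+ 2], combined with the symmetry of
    [oppoly p T]. *)
Lemma oppoly_nrm_le p T c : selfadjoint T -> 0 <= c ->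
  (forall a, spectrum T a%:C -> `|p.[a]| <= c) ->
  forall x, nrm (oppoly p T x) <= c * nrm x.
Proof.
move=> sT c0 hp x; have [_ sp] := (selfadjointP _).1 (oppoly_selfadjoint p sT).
rewrite -ler_sqr ?nnegrE ?mulr_ge0 ?nrm_ge0// exprMn nrm_sqr -subr_ge0.
have := @oppoly_ge0 ((c ^+ 2)%:P - p * p) T sT _ x.
rewrite !oppolyE (oppolyM _ _ _ (bounded_lin sT.1)) !ripE nrm_sqr sp; apply => a ha.
rewrite !hornerE subr_ge0 -expr2 -(real_normK (num_real p.[a])).
by rewrite ler_sqr ?nnegrE ?hp.
Qed.

End PolynomialCalculus.
(** * Weierstrass approximation by Bernstein polynomials *)

Section Weierstrass.
Context {R : realType}.
Implicit Types (f : R -> R) (x y : R) (phi psi : nat -> R).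

Lemma within_continuous_dist (A : set R) f x : {within A, continuous f} -> A x ->
  forall e : R, 0 < e -> exists2 d : R, 0 < d &
    forall y, A y -> `|x - y| < d -> `|f x - f y| < e.
Proof.
move=> /subspace_continuousP cf Ax e e0.
have [d /= d0 hd] := (cvgrPdist_lt _ _).1 (cf x Ax) e e0.
by exists d => // y Ay xy; exact: hd.
Qed.

(** Heine-Cantor: near each point every small [d] works by the triangle inequality, and compactness
    turns this into one [d] for the whole interval. *)
Lemma uniformly_continuous_itv (a b : R) f : {within `[a, b], continuous f} ->
  forall e : R, 0 < e -> exists2 d : R, 0 < d &
    forall x y, x \in `[a, b] -> y \in `[a, b] -> `|x - y| < d -> `|f x - f y| <= e.
Proof.
move=> cf e e0.
pose P (d x : R) := x \in `[a, b] -> forall y, y \in `[a, b] ->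
  `|x - y| < d -> `|f x - f y| <= e.
have : \forall d \near 0^'+, `[a, b] `<=` P d.
  have ncov := (compact_near_coveringP _).1 (@segment_compact R a b).
  apply: (ncov R (0^'+) P) => x xab.
  have e20 : 0 < e / 2 by lra.
  have [d d0 hd] := within_continuous_dist cf xab e20.
  have d20 : 0 < d / 2 by lra.
  exists (ball x (d / 2), [set r : R | r < d / 2]) => /=.
    split; first exact: nbhsx_ballx.
    exact: nbhs_right_lt.
  case=> u r /= [xu rd] uab y yab uy.
  rewrite /ball /= in xu.
  have h1 := hd u uab; have h2 := hd y yab.
  have xy : `|x - y| < d.
    by apply: le_lt_trans (ler_distD u _ _) _; lra.
  apply: le_trans (ler_distD (f x) _ _) _; rewrite (distrC (f u)).
  have := h2 xy; have : `|x - u| < d by lra.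
  by move=> /h1; lra.
move=> [d /= d0 hd].
exists (d / 2) => [|x y xab yab xy]; first lra.
have d20 : 0 < d / 2 by lra.
apply: (hd (d / 2) _ d20 x xab xab y yab xy) => /=.
by rewrite sub0r normrN gtr0_norm; lra.
Qed.

(* [(bern n phi).[x]] is the expectation of [phi k] for [k] binomial with
   parameters [n] and [x]. *)
Fixpoint bern n phi : {poly R} :=
  if n is m.+1 then 'X * bern m (phi \o S) + (1 - 'X) * bern m phi
  else (phi 0)%:P.

Lemma bernS n phi x : (bern n.+1 phi).[x]
  = x * (bern n (phi \o S)).[x] + (1 - x) * (bern n phi).[x].
Proof. by rewrite /= !hornerE. Qed.

(** Monotonicity of the expectation, since the weights [x] and [1 - x] are nonnegative. *)
Lemma bern_le n phi psi x : 0 <= x <= 1 ->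
  (forall k, (k <= n)%N -> phi k <= psi k) -> (bern n phi).[x] <= (bern n psi).[x].
Proof.
move=> /andP[x0 x1]; elim: n phi psi => [|n IH] phi psi h.
  by rewrite !hornerC h.
rewrite !bernS lerD// ler_wpM2l// ?subr_ge0//; apply: IH => k kn.
  exact: h.
by apply: h; rewrite (leq_trans kn).
Qed.

(** The moments of the binomial law: mean [n x] and variance [n x (1 - x)]. *)
Lemma bern_quad n (a b c : R) x :
  (bern n (fun k => a + b * k%:R + c * k%:R ^+ 2)).[x]
    = a + b * (n%:R * x) + c * (n%:R * x * (1 - x) + (n%:R * x) ^+ 2).
Proof.
elim: n a b c => [|n IH] a b c; first by rewrite /= hornerC; ring.
rewrite bernS IH.
have -> : (fun k : nat => a + b * k%:R + c * k%:R ^+ 2) \o S =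
    (fun k : nat => (a + b + c) + (b + 2 * c) * k%:R + c * k%:R ^+ 2).
  by apply/funext => k /=; rewrite -[k.+1%:R]natr1; ring.
by rewrite IH -[n.+1%:R]natr1; ring.
Qed.

(** Bernstein's proof: [f (K s)] differs from [f (K t)] by at most [e / 2 + C (s - t)^2]. Taking the
    expectation over [s = k / n] turns the square into the variance [t (1 - t) / n]. *)
Lemma weierstrass (K : R) f : 0 < K -> {within `[0, K], continuous f} ->
  forall e : R, 0 < e -> exists p : {poly R},
    forall x, 0 <= x <= K -> `|p.[x] - f x| <= e.
Proof.
move=> K0 cf e e0.
have [u _ hu] := EVT_max (ltW K0) cf; have [v _ hv] := EVT_min (ltW K0) cf.
have e20 : 0 < e / 2 by lra.
have [d d0 hd] := uniformly_continuous_itv cf e20.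
(* The oscillation of [f], scaled so that [C (s - t)^2] dominates it as soon as [K s] and [K t] are
   at distance at least [d]. *)
pose C := `|f u - f v| * K ^+ 2 / d ^+ 2.
have C0 : 0 <= C by apply: divr_ge0; [apply: mulr_ge0|]; rewrite ?normr_ge0 ?sqr_ge0.
have fC (s t : R) : 0 <= s <= 1 -> 0 <= t <= 1 ->
    `|f (K * s) - f (K * t)| <= e / 2 + C * (s - t) ^+ 2.
  have KI r : 0 <= r <= 1 -> K * r \in `[0, K].
    move=> /andP[r0 r1]; rewrite in_itv /= mulr_ge0 ?(ltW K0)//=.
    by rewrite -[leRHS]mulr1 ler_pM2l.
  move=> /KI sI /KI tI; have [st|st] := ltP `|K * s - K * t| d.
    by apply: le_trans (hd _ _ sI tI st) _; rewrite lerDl mulr_ge0 ?sqr_ge0.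
  apply: (@le_trans _ _ `|f u - f v|).
    have := ler_norm (f u - f v).
    have := hu _ sI; have := hu _ tI; have := hv _ sI; have := hv _ tI.
    by rewrite ler_norml; move=> *; apply/andP; split; lra.
  apply: (@le_trans _ _ (C * (s - t) ^+ 2)); last by lra.
  have -> : C * (s - t) ^+ 2 = `|f u - f v| * ((K * s - K * t) ^+ 2 / d ^+ 2).
    by rewrite /C; field; rewrite gt_eqF.
  rewrite ler_peMr// ler_pdivlMr ?exprn_gt0// mul1r.
  by rewrite -(real_normK (num_real (K * s - K * t))) ler_sqr ?nnegrE ?(ltW d0).
have Ce : 0 < e / 2 / (C + 1) by rewrite divr_gt0// ltr_wpDl.
have [N /(_ _ (leqnn N)) hN] := exists_invS Ce.
have [n nE] : exists n : R, n = N.+1%:R by exists N.+1%:R.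
have n0 : 0 < n by rewrite nE ltr0n.
rewrite -nE in hN.
(* The Bernstein polynomial of the function rescaled to [[0, 1]], transported back to [[0, K]]. *)
exists (bern N.+1 (fun k => f (K * (k%:R / n))) \Po (K^-1 *: 'X)) => x /andP[x0 xK].
rewrite horner_comp hornerZ hornerX; set t := K^-1 * x.
have xE : x = K * t by rewrite /t mulVKf// gt_eqF.
have t01 : 0 <= t <= 1.
  by rewrite /t mulr_ge0 ?invr_ge0 ?(ltW K0)//= mulrC ler_pdivrMr// mul1r.
have k01 k : (k <= N.+1)%N -> 0 <= k%:R / n <= 1.
  by move=> kn; rewrite divr_ge0 ?(ltW n0)//= ler_pdivrMr// mul1r nE ler_nat.
have eC (k : nat) : C * (k%:R / n - t) ^+ 2
    = C * t ^+ 2 - 2 * C * t / n * k%:R + C / n ^+ 2 * k%:R ^+ 2.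
  by field; rewrite gt_eqF.
have small : C * (t * (1 - t) / n) <= e / 2.
  have tt : t * (1 - t) <= 1 by case/andP: t01 => ? ?; nra.
  have : C * (t * (1 - t) / n) <= C * n^-1.
    by rewrite ler_wpM2l// -[leRHS]mul1r ler_wpM2r// invr_ge0 ltW.
  move/le_trans; apply; have nV : n^-1 < e / 2 / (C + 1) by [].
  have Cpos : 0 < C + 1 by rewrite ltr_wpDl.
  move: nV; rewrite ltr_pdivlMr// => nV.
  have : 0 < n^-1 by rewrite invr_gt0.
  by move: nV; move: (n^-1) => r; lra.
rewrite [in f x]xE ler_norml lerBlDl; apply/andP; split.
  have := @bern_le N.+1
    (fun k => (f (K * t) - e / 2 - C * t ^+ 2) + (2 * C * t / n) * k%:R
              + (- (C / n ^+ 2)) * k%:R ^+ 2) (fun k => f (K * (k%:R / n))) t t01.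
  rewrite bern_quad -nE.
  have -> : f (K * t) - e / 2 - C * t ^+ 2 + 2 * C * t / n * (n * t) +
      - (C / n ^+ 2) * (n * t * (1 - t) + (n * t) ^+ 2)
      = f (K * t) - e / 2 - C * (t * (1 - t) / n).
    by field; rewrite gt_eqF.
  move=> h; rewrite lerBrDl; apply: (le_trans _ (h _)); first by lra.
  move=> k kn; have := fC _ _ (k01 k kn) t01; rewrite eC ler_norml.
  by case/andP; lra.
have := @bern_le N.+1 (fun k => f (K * (k%:R / n)))
    (fun k => (f (K * t) + e / 2 + C * t ^+ 2) + (- (2 * C * t / n)) * k%:R
              + (C / n ^+ 2) * k%:R ^+ 2) t t01.
rewrite bern_quad -nE.
have -> : f (K * t) + e / 2 + C * t ^+ 2 + - (2 * C * t / n) * (n * t) +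
    C / n ^+ 2 * (n * t * (1 - t) + (n * t) ^+ 2)
    = f (K * t) + e / 2 + C * (t * (1 - t) / n).
  by field; rewrite gt_eqF.
move=> h; apply: le_trans (h _) _; last by lra.
move=> k kn; have := fC _ _ (k01 k kn) t01; rewrite eC ler_norml.
by case/andP; lra.
Qed.

End Weierstrass.
(** * The operator norm *)

(** Using the tolerance [e / (c + 1)] covers the case [c = 0]. *)
Lemma le_eps_mul {R : realType} (a b c : R) : 0 <= c ->
  (forall e, 0 < e -> a <= b + e * c) -> a <= b.
Proof.
move=> c0 h; apply/ler_addgt0Pr => e e0.
have c1 : 0 < c + 1 by rewrite ltr_wpDl.
apply: le_trans (h (e / (c + 1)) _) _; first by rewrite divr_gt0.
by rewrite lerD2l mulrAC ler_pdivrMr// ler_wpM2l ?(ltW e0)// lerDl.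
Qed.

Section OperatorNorm.
Context {R : realType} {H : hilbertType R}.
Implicit Types (x y : H) (a c e : R) (S T B : H -> H) (f : R -> R) (p q : {poly R}).

Lemma opnorm_ubound T c : 0 <= c -> (forall x, nrm (T x) <= c * nrm x) ->
  ubound [set complex.Re `|T x| | x in [set x : H | `|x| <= 1]] c.
Proof.
move=> c0 h _ [x /= x1 <-]; apply: le_trans (h x) _.
rewrite -[leRHS]mulr1 ler_wpM2l//.
by move: x1; rewrite nrmE -(rmorph1 (real_complex R)) lecR.
Qed.

Lemma opnorm_le T c : 0 <= c -> (forall x, nrm (T x) <= c * nrm x) -> opnorm T <= c.
Proof.
move=> c0 h; apply: ge_sup; last exact: opnorm_ubound.
by exists (complex.Re `|T 0|), 0 => //=; rewrite normr0.
Qed.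

Lemma nrm_le_opnorm T x : bounded_operator T -> nrm (T x) <= opnorm T * nrm x.
Proof.
move=> bT; have [lT [K K0 hK]] := (bounded_operatorP T).1 bT.
have [->|x0] := eqVneq x 0; first by rewrite (lin0 lT) nrm0 mulr0.
have n0 := nrm_gt0 x0.
rewrite -ler_pdivrMr//; apply: sup_ubound.
  by exists K; exact: opnorm_ubound.
exists ((nrm x)^-1%:C *: x) => /=.
  rewrite nrmE nrmZ ger0_norm ?invr_ge0 ?(ltW n0)// mulVf ?gt_eqF//.
rewrite -/(nrm _) (linZ _ _ lT) nrmZ ger0_norm ?invr_ge0 ?(ltW n0)//.
by rewrite mulrC.
Qed.

Lemma opnorm_ge0 T : bounded_operator T -> 0 <= opnorm T.
Proof.
move=> bT; have [lT [K K0 hK]] := (bounded_operatorP T).1 bT.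
apply: sup_ubound.
  by exists K; exact: opnorm_ubound.
by exists 0 => /=; rewrite ?normr0 // (lin0 lT) normr0.
Qed.

Lemma cvg_opnormP (u : nat -> H -> H) : (forall n, bounded_operator (u n)) ->
  ((fun n => opnorm (u n)) @ \oo --> (0 : R)) <->
  (forall e, 0 < e -> exists N, forall n, (N <= n)%N ->
     forall x, nrm (u n x) <= e * nrm x).
Proof.
move=> bu; split=> [/cvgr0Pnorm_lt h e e0|h].
  have [N _ hN] := h e e0; exists N => n Nn x.
  apply: le_trans (nrm_le_opnorm _ (bu n)) _; rewrite ler_wpM2r ?nrm_ge0//.
  exact: le_trans (ler_norm _) (ltW (hN n Nn)).
apply/cvgr0Pnorm_le => e e0; have [N hN] := h e e0.
exists N => // n Nn; rewrite ger0_norm ?opnorm_ge0//.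
by apply: opnorm_le => [|x]; [exact: ltW | exact: hN].
Qed.

(** The pointwise limit exists by completeness of [H] and inherits the uniform Cauchy estimate, from
    which linearity and boundedness follow. *)
Lemma operator_complete (u : nat -> H -> H) : (forall n, bounded_operator (u n)) ->
  (forall e, 0 < e -> exists N, forall m n, (N <= m)%N -> (N <= n)%N ->
     forall x, nrm (u m x - u n x) <= e * nrm x) ->
  exists2 B, bounded_operator B &
    forall e, 0 < e -> exists N, forall n, (N <= n)%N ->
     forall x, nrm (u n x - B x) <= e * nrm x.
Proof.
move=> bu cu.
have /choice[B hB] : forall x, exists l, forall e : R, 0 < e -> exists N,
    forall n, (N <= n)%N -> nrm (u n x - l) < e.
  move=> x; apply: hilbert_complete => e e0.
  have x1 : 0 < nrm x + 1 by rewrite ltr_wpDl ?nrm_ge0.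
  have [N hN] := cu (e / (nrm x + 1)) (divr_gt0 e0 x1).
  exists N => m n Nm Nn; apply: le_lt_trans (hN m n Nm Nn x) _.
  by rewrite mulrAC ltr_pdivrMr// ltr_pM2l// ltrDl.
have uB e : 0 < e -> exists N, forall n, (N <= n)%N ->
     forall x, nrm (u n x - B x) <= e * nrm x.
  move=> e0; have [N hN] := cu e e0; exists N => n Nn x.
  (* The intermediate index depends on [x] and [d], but the resulting bound does so only through
     [d], which is arbitrary. *)
  apply/ler_addgt0Pr => d d0; have [M hM] := hB x d d0.
  apply: le_trans (nrm_sub_trans _ (u (maxn N M) x) _) _.
  by rewrite lerD ?hN ?leq_maxl// ltW// hM// leq_maxr.
exists B => //.
have lB : linear B.
  move=> a x y; apply/eqP; rewrite -subr_eq0 -nrm_eq0 eq_le nrm_ge0 andbT.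
  apply: (@le_eps_mul _ _ _ (nrm (a *: x + y) + (nrm (a *: x) + nrm y))).
    by rewrite !addr_ge0 ?nrm_ge0.
  move=> e e0; have [N /(_ N (leqnn N)) hN] := uB e e0.
  have lu := bounded_lin (bu N).
  (* As [u N] is linear, the linearity defect of [B] consists of differences between [u N] and [B]
     only. *)
  have -> : B (a *: x + y) - (a *: B x + B y)
      = - (u N (a *: x + y) - B (a *: x + y)) + (a *: (u N x - B x) + (u N y - B y)).
    by rewrite scalerBr opprB [X in _ = _ + X]addrACA -opprD -lu subrKA.
  rewrite add0r mulrDr; apply: le_trans (nrmD _ _) _; rewrite nrmN lerD//.
  rewrite mulrDr; apply: le_trans (nrmD _ _) _; rewrite lerD//.
  rewrite !nrmZc mulrCA; apply: ler_wpM2l => //.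
  by rewrite -ler0c RRe_real ?normr_real// normr_ge0.
have [N /(_ N (leqnn N)) hN] := uB 1 ltr01.
have [_ [K K0 hK]] := (bounded_operatorP (u N)).1 (bu N).
apply/bounded_operatorP; split=> //; exists (1 + K); first by rewrite addr_ge0.
move=> x; have {1}-> : B x = - (u N x - B x) + u N x by rewrite opprB subrK.
by rewrite mulrDl; apply: le_trans (nrmD _ _) _; rewrite nrmN lerD.
Qed.

End OperatorNorm.
(** * Continuous functional calculus *)

Lemma uniform_cvgP {R : realType} (A : set R) (F : nat -> R -> R) (f : R -> R) :
  {uniform A, F @ \oo --> f} <->
  (forall e : R, 0 < e -> exists N, forall n, (N <= n)%N ->
     forall x, A x -> `|F n x - f x| < e).
Proof.
split=> [h e e0|h P /uniform_nbhs[E [entE EP]]].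
  have [|N _ hN] := h [set g | forall x, A x -> `|g x - f x| < e].
    apply/uniform_nbhs; exists [set xy | ball xy.1 e xy.2].
    split; first exact: entourage_ball (PosNum e0).
    by move=> g /= hg x Ax; rewrite distrC; exact: hg.
  by exists N => n Nn x Ax; exact: hN.
move: entE; rewrite -entourage_ballE => -[e /= e0 eE].
have [N hN] := h e e0; exists N => // n Nn; apply: EP => x Ax.
by apply: eE => /=; rewrite /ball /= distrC; exact: hN.
Qed.

Section FunctionalCalculus.
Context {R : realType} {H : hilbertType R}.
Implicit Types (x y : H) (a c e : R) (S T B : H -> H) (f g : R -> R) (p q : {poly R}).

(** One polynomial per tolerance instead of a sequence; conversely, the tolerances [1 / (n + 1)]
    yield a sequence. *)
Lemma is_cfcP f T B : bounded_operator T ->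
  is_cfc f T B <-> bounded_operator B /\
    forall e, 0 < e -> exists2 p,
      (forall a, spectrum T a%:C -> `|p.[a] - f a| <= e) &
      (forall x, nrm (oppoly p T x - B x) <= e * nrm x).
Proof.
move=> bT; split=> [[bB [p /uniform_cvgP pf pB]]|[bB h]]; split=> //.
  move=> e e0; have [N hN] := pf e e0.
  have bu n : bounded_operator (oppoly (p n) T - B).
    by apply: bounded_B => //; exact: oppoly_bounded.
  have [M hM] := (cvg_opnormP bu).1 pB e e0.
  exists (p (maxn N M)) => [a sa|]; first exact/ltW/hN/sa/leq_maxl.
  exact/hM/leq_maxr.
have /choice[p hp] : forall n : nat, exists p : {poly R},
    (forall a, spectrum T a%:C -> `|p.[a] - f a| <= n.+1%:R^-1) /\
    (forall x, nrm (oppoly p T x - B x) <= n.+1%:R^-1 * nrm x).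
  move=> n; have n0 : 0 < n.+1%:R^-1 :> R by rewrite invr_gt0.
  by have [p h1 h2] := h _ n0; exists p.
exists p.
  apply/uniform_cvgP => e e0; have [N hN] := exists_invS e0.
  by exists N => n Nn a sa; apply: le_lt_trans ((hp n).1 a sa) (hN n Nn).
apply/cvg_opnormP => [n|e e0].
  by apply: bounded_B => //; exact: oppoly_bounded.
have [N hN] := exists_invS e0; exists N => n Nn x.
by apply: le_trans ((hp n).2 x) _; rewrite ler_wpM2r ?nrm_ge0// ltW// hN.
Qed.

Lemma is_cfcN f T B : bounded_operator T -> is_cfc f T B ->
  is_cfc (fun a => - f a) T (- B).
Proof.
move=> bT /(is_cfcP _ _ bT)[bB h]; apply/is_cfcP => //; split; first exact: bounded_N.
move=> e /h[p p1 p2]; exists (- p) => [a /p1|x].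
  by rewrite hornerN -opprD normrN.
by rewrite oppolyN opN -opprD nrmN.
Qed.

(** If [p] is within [e] of [f] on the spectrum, then [p - q + e] is nonnegative there, so
    [oppoly_ge0] applies. *)
Lemma is_cfc_ge f T B q : selfadjoint T -> is_cfc f T B ->
  (forall a, spectrum T a%:C -> q.[a] <= f a) ->
  forall x, rip (oppoly q T x) x <= rip (B x) x.
Proof.
move=> sT /(is_cfcP _ _ sT.1)[bB h] qf x.
(* One [e] comes from the shift of the polynomial, the other from replacing [oppoly p T] by [B]. *)
apply: (@le_eps_mul _ _ _ (2 * nrm x ^+ 2)); first by rewrite mulr_ge0 ?sqr_ge0.
move=> e e0; have [p p1 p2] := h e e0.
have := @oppoly_ge0 _ _ (p - q + e%:P) T sT _ x.
rewrite !oppolyE !ripE -nrm_sqr => pos.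
have : 0 <= rip (oppoly p T x) x - rip (oppoly q T x) x + e * nrm x ^+ 2.
  apply: pos => a sa; rewrite !hornerE.
  by have := p1 a sa; have := qf a sa; rewrite ler_norml => ? /andP[]; lra.
have : rip (oppoly p T x) x - rip (B x) x <= e * nrm x ^+ 2.
  rewrite -ripBl; apply: le_trans (ler_norm _) _; apply: le_trans (rip_le _ _) _.
  by rewrite expr2 mulrA ler_wpM2r ?nrm_ge0.
lra.
Qed.

Lemma is_cfc_le f T B q : selfadjoint T -> is_cfc f T B ->
  (forall a, spectrum T a%:C -> f a <= q.[a]) ->
  forall x, rip (B x) x <= rip (oppoly q T x) x.
Proof.
move=> sT hB fq x.
have := @is_cfc_ge _ T (- B) (- q) sT (is_cfcN sT.1 hB) _ x.
rewrite oppolyN opN !ripNl lerN2; apply => a sa.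
by rewrite hornerN lerN2 fq.
Qed.

Lemma is_cfc_selfadjoint f T B : selfadjoint T -> is_cfc f T B -> selfadjoint B.
Proof.
move=> sT /(is_cfcP _ _ sT.1)[bB h]; apply/selfadjointP; split=> // x y.
apply/eqP; rewrite -subr_eq0 -normr_eq0 eq_le normr_ge0 andbT.
apply: (@le_eps_mul _ _ _ (2 * (nrm x * nrm y))).
  by rewrite !mulr_ge0 ?nrm_ge0.
move=> e e0; have [p p1 p2] := h e e0; rewrite add0r.
have [_ sp] := (selfadjointP _).1 (oppoly_selfadjoint p sT).
have -> : rip (B x) y - rip x (B y)
    = rip x (oppoly p T y - B y) - rip (oppoly p T x - B x) y.
  by rewrite ripBr ripBl sp; ring.
apply: le_trans (ler_normB _ _) _.
have h1 : `|rip x (oppoly p T y - B y)| <= e * (nrm x * nrm y).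
  apply: le_trans (rip_le _ _) _.
  by rewrite [leRHS]mulrCA ler_wpM2l ?nrm_ge0.
have h2 : `|rip (oppoly p T x - B x) y| <= e * (nrm x * nrm y).
  by apply: le_trans (rip_le _ _) _; rewrite mulrA ler_wpM2r ?nrm_ge0.
lra.
Qed.

(** [is_cfc] provides some approximating polynomials; comparison with one of them extends the
    estimate to any polynomial close to [f] on the spectrum. Uniqueness of [B] is built into
    this. *)
Lemma is_cfc_approx f T B p e : selfadjoint T -> is_cfc f T B -> 0 <= e ->
  (forall a, spectrum T a%:C -> `|p.[a] - f a| <= e) ->
  forall x, nrm (oppoly p T x - B x) <= e * nrm x.
Proof.
move=> sT /(is_cfcP _ _ sT.1)[bB h] e0 pf x.
apply: (@le_eps_mul _ _ _ (2 * nrm x)); first by rewrite mulr_ge0 ?nrm_ge0.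
move=> d d0; have [q q1 q2] := h d d0.
apply: le_trans (nrm_sub_trans _ (oppoly q T x) _) _.
have : nrm (oppoly (p - q) T x) <= (e + d) * nrm x.
  apply: oppoly_nrm_le => //; first by rewrite addr_ge0// ltW.
  move=> a sa; rewrite !hornerE; apply: le_trans (ler_distD (f a) _ _) _.
  by rewrite lerD ?pf// distrC q1.
rewrite oppolyD oppolyN; have := q2 x; lra.
Qed.

(** Polynomials converging uniformly on the spectrum are Cauchy there, so [oppoly_nrm_le] makes
    their values at [T] Cauchy in norm. *)
Lemma cfc_exists f T : selfadjoint T ->
  (forall e, 0 < e -> exists p : {poly R},
     forall a, spectrum T a%:C -> `|p.[a] - f a| <= e) ->
  is_cfc f T (cfc f T).
Proof.
move=> sT h; apply: (@xgetPex _ 0 (is_cfc f T)).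
have /choice[p hp] : forall n : nat, exists p : {poly R},
    forall a, spectrum T a%:C -> `|p.[a] - f a| <= n.+1%:R^-1.
  by move=> n; apply: h; rewrite invr_gt0.
have [||B bB hB] := @operator_complete _ _ (fun n => oppoly (p n) T).
- by move=> n; exact/oppoly_bounded/sT.1.
- move=> e e0; have e20 : 0 < e / 2 by lra.
  have [N hN] := exists_invS e20; exists N => m n Nm Nn x.
  rewrite -oppolyN -oppolyD; apply: oppoly_nrm_le => [//||a sa]; first exact: ltW.
  rewrite !hornerE; apply: le_trans (ler_distD (f a) _ _) _.
  have h1 := le_trans (hp m a sa) (ltW (hN m Nm)).
  have h2 := le_trans (hp n a sa) (ltW (hN n Nn)).
  by rewrite (distrC (f a)); lra.
exists B; apply/(is_cfcP _ _ sT.1); split=> // e e0.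
have [N hN] := hB e e0; have [M hM] := exists_invS e0.
exists (p (maxn N M)) => [a sa|]; last exact/hN/leq_maxl.
by apply: le_trans (hp _ a sa) (ltW (hM _ (leq_maxr _ _))).
Qed.

Lemma bounded_rip T : bounded_operator T -> exists2 K : R, 0 < K &
  (forall x, nrm (T x) <= K * nrm x) /\ (forall x, rip (T x) x <= K * nrm x ^+ 2).
Proof.
move=> /bounded_operatorP[lT [K K0 hK]].
have hK1 x : nrm (T x) <= (K + 1) * nrm x.
  by apply: le_trans (hK x) _; rewrite ler_wpM2r ?nrm_ge0// lerDl.
exists (K + 1); first by rewrite ltr_wpDl.
split=> // x; apply: le_trans (ler_norm _) _; apply: le_trans (rip_le _ _) _.
by rewrite expr2 mulrA ler_wpM2r ?nrm_ge0.
Qed.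

Lemma rpos_spectrum T a : selfadjoint T -> rpos T -> spectrum T a%:C -> 0 <= a.
Proof. by move=> sT pT; apply: spectrum_ge => // x; rewrite mul0r. Qed.

Lemma cfc_spec f T : selfadjoint T -> rpos T ->
  {within `[0, +oo[, continuous f} -> is_cfc f T (cfc f T).
Proof.
move=> sT pT cf; have [K K0 [_ hK]] := bounded_rip sT.1.
apply: cfc_exists => // e e0.
have [|p hp] := weierstrass K0 (f := f) _ e0.
  apply: continuous_subspaceW cf => x /=.
  by rewrite !in_itv /= andbT => /andP[].
exists p => a sa; apply: hp.
by rewrite (rpos_spectrum sT pT sa) (spectrum_le sT hK sa).
Qed.

End FunctionalCalculus.
(** * Square roots and the mixed Schwarz inequality *)

Section PositiveSquareRoot.
Context {R : realType} {H : hilbertType R}.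
Implicit Types (x y : H) (a c e : R) (S T B : H -> H) (p q : {poly R}).

Lemma sqrt_within (A : set R) : {within A, continuous (@Num.sqrt R)}.
Proof. by apply: continuous_subspaceT; exact: sqrt_continuous. Qed.

(** If [p] is close to the square root on the spectrum, then [p ^+ 2] is close to ['X], by factoring
    the difference of squares. *)
Lemma cfc_sqrtP T : selfadjoint T -> rpos T ->
  let B := cfc Num.sqrt T in
  [/\ selfadjoint B, rpos B & forall x, B (B x) = T x].
Proof.
move=> sT pT B; have hB : is_cfc Num.sqrt T B by exact/cfc_spec/sqrt_within.
have sB := is_cfc_selfadjoint sT hB; split=> // x.
  have := @is_cfc_ge _ _ _ T B 0 sT hB _ x.
  by rewrite -polyC0 oppolyC scale0r rip0l; apply => a _; rewrite hornerC sqrtr_ge0.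
have [K K0 [_ hK]] := bounded_rip sT.1; have [M M0 [hM _]] := bounded_rip sB.1.
have lB := bounded_lin sB.1; have lT := bounded_lin sT.1.
pose L := Num.sqrt K; have L0 : 0 <= L by exact: sqrtr_ge0.
apply/eqP; rewrite -subr_eq0 -nrm_eq0 eq_le nrm_ge0 andbT.
(* The summands [1 + 2 * L], [M + 1] and [M] are the errors in passing from [T] to [p(T) p(T)], then
   to [B p(T)], then to [B B]. *)
apply: (@le_eps_mul _ _ _ ((1 + 2 * L + (M + 1) + M) * nrm x)).
  by rewrite mulr_ge0 ?nrm_ge0// !addr_ge0// ?mulr_ge0// ltW.
(* The bound [e <= 1] limits [p] on the spectrum and the norm of [p(T)], which is at most
   [M + 1]. *)
move=> d d0; pose e := Num.min d 1; have e0 : 0 < e by rewrite lt_min d0 ltr01.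
have ed : e <= d by rewrite ge_min lexx.
have e1 : e <= 1 by rewrite ge_min lexx orbT.
have [p p1 p2] := ((is_cfcP _ _ sT.1).1 hB).2 e e0.
have h1 : nrm (oppoly (p * p - 'X) T x) <= e * (1 + 2 * L) * nrm x.
  apply: oppoly_nrm_le => [//||a sa].
    by rewrite mulr_ge0 ?(ltW e0)// addr_ge0// mulr_ge0.
  have a0 := rpos_spectrum sT pT sa; rewrite !hornerE.
  have s0 : 0 <= Num.sqrt a := sqrtr_ge0 a.
  have sL : Num.sqrt a <= L by rewrite ler_wsqrtr// (spectrum_le sT hK sa).
  rewrite -[X in _ - X](sqr_sqrtr a0) -expr2 subr_sqr normrM ler_pM//; first exact: p1.
  have -> : p.[a] + Num.sqrt a = (p.[a] - Num.sqrt a) + 2 * Num.sqrt a by ring.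
  apply: le_trans (ler_normD _ _) _; rewrite lerD ?(le_trans (p1 a sa))//.
  by rewrite ger0_norm ?mulr_ge0// ler_wpM2l.
have h2 : nrm (oppoly p T (oppoly p T x) - B (oppoly p T x)) <= e * ((M + 1) * nrm x).
  apply: le_trans (p2 _) _; rewrite ler_wpM2l ?(ltW e0)//.
  have -> : oppoly p T x = B x + (oppoly p T x - B x) by rewrite addrC subrK.
  rewrite mulrDl; apply: le_trans (nrmD _ _) _; rewrite lerD//.
  by apply: le_trans (p2 x) _; rewrite ler_wpM2r ?nrm_ge0.
have h3 : nrm (B (oppoly p T x) - B (B x)) <= e * M * nrm x.
  rewrite -(linB _ _ lB); apply: le_trans (hM _) _.
  by rewrite [e * M]mulrC -mulrA ler_wpM2l ?(ltW M0).
rewrite add0r; apply: (@le_trans _ _ (e * ((1 + 2 * L + (M + 1) + M) * nrm x))); last first.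
  by rewrite ler_wpM2r// mulr_ge0 ?nrm_ge0// !addr_ge0// ?mulr_ge0// ltW.
move: h1; rewrite oppolyD oppolyN (oppolyM _ _ _ lT) oppolyX => h1.
have := nrm_sub_trans (T x) (oppoly p T (oppoly p T x)) (B (B x)).
have := nrm_sub_trans (oppoly p T (oppoly p T x)) (B (oppoly p T x)) (B (B x)).
rewrite (nrmB (B (B x))) (nrmB (T x) (oppoly p T _)); lra.
Qed.

(** A positive [S] need not be invertible, but [S + e] is coercive with constant [e]. *)
Lemma rpos_shift_solve S e y : selfadjoint S -> rpos S -> 0 < e ->
  exists x, S x + e%:C *: x = y.
Proof.
move=> /selfadjointP[bS sS] pS e0; pose D := S + e%:C *: idfun.
have bD : bounded_operator D by apply: bounded_D => //; exact/bounded_Z/bounded_id.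
have [_ [K _ hK]] := (bounded_operatorP D).1 bD.
have [|u|u v|a u|u|x hx] := @coercive_solve _ _ D (rip y) K e (nrm y) (bounded_lin bD) _ hK e0.
- by move=> u v; rewrite /D !opE !ripE sS.
- by rewrite /D !opE ripDl ripZl -nrm_sqr lerDr.
- by rewrite ripDr.
- by rewrite ripZr.
- exact: le_trans (ler_norm _) (rip_le _ _).
exists x; apply/eqP; rewrite -subr_eq0 -nrm_eq0 -sqrf_eq0 nrm_sqr ripBl.
by rewrite -[S x + _]/(D x) hx subrr.
Qed.

Lemma rpos_shift_inj S e x : rpos S -> 0 < e -> S x + e%:C *: x = 0 -> x = 0.
Proof.
move=> pS e0 h; apply/eqP; rewrite -nrm_eq0 -sqrf_eq0 eq_le sqr_ge0 andbT.
rewrite -(ler_pM2l e0) mulr0 nrm_sqr.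
have := pS x; have : rip (S x + e%:C *: x) x = 0 by rewrite h rip0l.
by rewrite ripDl ripZl; lra.
Qed.

Variable A : H -> H.
Hypothesis bA : bounded_operator A.
Let A' := adjoint A.
Let P := opabs A.
Let Q := opabs A'.

Let bA' : bounded_operator A'. Proof. exact: adjoint_bounded. Qed.
Let QE : Q = cfc Num.sqrt (A \o A'). Proof. by rewrite /Q /opabs /A' adjointK. Qed.
Let rA x y : rip (A x) y = rip x (A' y).
Proof. by rewrite /rip (adjointP bA). Qed.
Let rA' x y : rip (A' x) y = rip x (A y).
Proof. by rewrite ripC -rA ripC. Qed.

Lemma adjoint_mul_selfadjoint : selfadjoint (A' \o A) /\ rpos (A' \o A).
Proof.
split; last by move=> x; rewrite /= rA' -nrm_sqr sqr_ge0.
apply/selfadjointP; split; first exact: bounded_comp.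
by move=> x y; rewrite /= rA' rA.
Qed.

Lemma mul_adjoint_selfadjoint : selfadjoint (A \o A') /\ rpos (A \o A').
Proof.
split; last by move=> x; rewrite /= rA -nrm_sqr sqr_ge0.
apply/selfadjointP; split; first exact: bounded_comp.
by move=> x y; rewrite /= rA rA'.
Qed.

Lemma opabsP : [/\ selfadjoint P, rpos P & forall x, P (P x) = A' (A x)].
Proof. by have [sT pT] := adjoint_mul_selfadjoint; exact: cfc_sqrtP. Qed.

Lemma opabs_adjointP : [/\ selfadjoint Q, rpos Q & forall x, Q (Q x) = A (A' x)].
Proof. by have [sT pT] := mul_adjoint_selfadjoint; rewrite QE; exact: cfc_sqrtP. Qed.

Lemma nrm_opabs_adjoint x : nrm (Q x) = nrm (A' x).
Proof.
have [/selfadjointP[_ sQ] _ QQ] := opabs_adjointP.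
apply/eqP; rewrite -(eqrXn2 (n := 2)) ?nrm_ge0//; apply/eqP.
by rewrite !nrm_sqr sQ QQ rA'.
Qed.

(** For a polynomial [p], applying [p] to [A' \o A] and then [A] is the same as applying [A] and
    then [p] of [A \o A']. The claim is the limit as [p] tends to the square root. *)
Lemma opabs_intertwine x : A (P x) = Q (A x).
Proof.
have [sT pT] := adjoint_mul_selfadjoint; have [sS pS] := mul_adjoint_selfadjoint.
have lA := bounded_lin bA.
have hP : is_cfc Num.sqrt (A' \o A) P by exact/cfc_spec/sqrt_within.
have hQ : is_cfc Num.sqrt (A \o A') Q by rewrite QE; exact/cfc_spec/sqrt_within.
have [K1 K10 [_ hK1]] := bounded_rip sT.1; have [K2 K20 [_ hK2]] := bounded_rip sS.1.
have [M M0 [hM _]] := bounded_rip bA.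
(* The interval from [0] to [K1 + K2] contains both spectra, so one polynomial serves both
   operators. *)
have K0 : 0 < K1 + K2 by rewrite addr_gt0.
apply/eqP; rewrite -subr_eq0 -nrm_eq0 eq_le nrm_ge0 andbT.
apply: (@le_eps_mul _ _ _ (2 * M * nrm x)).
  by rewrite !mulr_ge0 ?nrm_ge0// ltW.
move=> e e0; have [p hp] := weierstrass K0 (@sqrt_within _) e0; rewrite add0r.
have pP y : nrm (oppoly p (A' \o A) y - P y) <= e * nrm y.
  apply: is_cfc_approx hP (ltW e0) _ y => // a sa; apply: hp.
  rewrite (rpos_spectrum sT pT sa)/= (le_trans (spectrum_le sT hK1 sa))//.
  by rewrite lerDl ltW.
have pQ y : nrm (oppoly p (A \o A') y - Q y) <= e * nrm y.
  apply: is_cfc_approx hQ (ltW e0) _ y => // a sa; apply: hp.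
  rewrite (rpos_spectrum sS pS sa)/= (le_trans (spectrum_le sS hK2 sa))//.
  by rewrite lerDr ltW.
have Ap y : A (oppoly p (A' \o A) y) = oppoly p (A \o A') (A y).
  elim/poly_ind: p y {hp pP pQ} => [|p c IH] y.
    by rewrite -polyC0 !oppolyC !scale0r (lin0 lA).
  by rewrite !oppolyD !oppolyMX !oppolyC (linD _ _ lA) (linZ _ _ lA) IH.
have h1 : nrm (A (P x) - A (oppoly p (A' \o A) x)) <= M * (e * nrm x).
  rewrite -(linB _ _ lA); apply: le_trans (hM _) _.
  by rewrite ler_wpM2l ?(ltW M0)// nrmB.
have h2 : nrm (oppoly p (A \o A') (A x) - Q (A x)) <= e * (M * nrm x).
  by apply: le_trans (pQ _) _; rewrite ler_wpM2l ?(ltW e0).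
rewrite Ap in h1.
have := nrm_sub_trans (A (P x)) (oppoly p (A \o A') (A x)) (Q (A x)); lra.
Qed.

(* With [u = (P + e)^-1 A^* y], Cauchy-Schwarz for [P + e] bounds
   [<A x, y> = <x, (P + e) u>]; moreover [A u = (Q + e)^-1 Q^2 y <= Q y]. *)
Lemma mixed_schwarz x y : rip (A x) y ^+ 2 <= rip (P x) x * rip (Q y) y.
Proof.
have [sP pP PP] := opabsP; have [sQ pQ QQ] := opabs_adjointP.
have lQ := bounded_lin sQ.1; have lP := bounded_lin sP.1; have lA := bounded_lin bA.
have [_ rP] := (selfadjointP P).1 sP; have [_ rQ] := (selfadjointP Q).1 sQ.
apply: (@le_eps_mul _ _ _ (nrm x ^+ 2 * rip (Q y) y)).
  by rewrite mulr_ge0 ?sqr_ge0.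
move=> e e0; have [u hu] := rpos_shift_solve (A' y) sP pP e0.
have [g hg] := rpos_shift_solve y sQ pQ e0.
pose D := P + e%:C *: idfun.
have Dlin : linear D.
  by apply: bounded_lin; apply: bounded_D sP.1 _; exact/bounded_Z/bounded_id.
have Dsym : rsym D by move=> v w; rewrite /D !opE !ripE rP.
have Dpos : rpos D.
  move=> v; rewrite /D !opE ripDl ripZl -nrm_sqr.
  exact: addr_ge0 (pP v) (mulr_ge0 (ltW e0) (sqr_ge0 _)).
have Du : D u = A' y by rewrite /D !opE.
have := rip_sqr_le x u Dlin Dsym Dpos; rewrite Dsym Du -rA => /le_trans; apply.
have -> : rip (A' y) u = rip y (A u) by rewrite rA'.
have hAu : Q (A u) + e%:C *: A u = Q (Q y).
  by rewrite -opabs_intertwine -(linZ _ _ lA) -(linD _ _ lA) hu QQ.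
(* Both sides have the same image under the injective operator [Q + e], where [g] solves
   [Q g + e g = y]. *)
have rE : Q y - A u = e%:C *: Q g.
  apply/eqP; rewrite -subr_eq0; apply/eqP; apply: (rpos_shift_inj pQ e0).
  pose E := Q + e%:C *: idfun.
  have lE : linear E.
    by apply: bounded_lin; apply: bounded_D sQ.1 _; exact/bounded_Z/bounded_id.
  rewrite -[LHS]/(E (Q y - A u - e%:C *: Q g)) !(linB _ _ lE) (linZ _ _ lE).
  have -> : E (Q g) = Q y by rewrite -hg (linD _ _ lQ) (linZ _ _ lQ).
  have -> : E (A u) = Q (Q y) by exact: hAu.
  have -> : E (Q y) = Q (Q y) + e%:C *: Q y by [].
  by rewrite [Q (Q y) + _]addrC addrK subrr.
(* The difference is [e] times [rip (Q g) (Q g + e g)], which is nonnegative. *)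
have le : rip y (A u) <= rip (Q y) y.
  rewrite -subr_ge0 [X in _ - X]ripC -ripBl rE ripZl mulr_ge0 ?(ltW e0)//.
  rewrite -[X in rip _ X]hg ripDr ripZr -nrm_sqr addr_ge0 ?sqr_ge0//.
  by rewrite mulr_ge0 ?(ltW e0).
have -> : rip (P x) x * rip (Q y) y + e * (nrm x ^+ 2 * rip (Q y) y)
    = rip (D x) x * rip (Q y) y.
  by rewrite /D !opE ripDl ripZl -nrm_sqr; ring.
by rewrite ler_wpM2l.
Qed.

End PositiveSquareRoot.
(** * Riemann sums *)

Section RiemannSums.
Context {R : realType} {H : hilbertType R}.
Implicit Types (v w : H) (a b c d e t : R) (F G : R -> H -> H) (B C : H -> H).
Implicit Types (n k : nat) (x xi : nat -> R) (g h : R -> H).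

(** Tagged partitions of [[0, 1]] of mesh below [d]; points may coincide, whereas [itv_partition]
    asks for strict increase. *)
Definition fine_tagged d n x xi := [/\ x 0%N = 0, x n = 1 &
  forall i, (i < n)%N -> [/\ x i <= x i.+1, x i.+1 - x i < d & x i <= xi i <= x i.+1]].

Definition rsum n x xi g : H := \sum_(i < n) (x i.+1 - x i)%:C *: g (xi i).

Lemma fine_tagged_itv d n x xi i : fine_tagged d n x xi -> (i <= n)%N -> 0 <= x i <= 1.
Proof.
move=> [x0 xn h] ni.
have mono j k : (j + k <= n)%N -> x j <= x (j + k)%N.
  elim: k => [|k IH]; first by rewrite addn0.
  rewrite addnS => jk; apply: le_trans (IH (ltnW jk)) _.
  by have [] := h _ jk.
have /= := mono 0%N i; rewrite add0n x0 => -> //.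
by have := mono i (n - i)%N; rewrite subnKC// xn => ->.
Qed.

Lemma fine_tagged_tag d n x xi i : fine_tagged d n x xi -> (i < n)%N -> 0 <= xi i <= 1.
Proof.
move=> hx ni; have [_ _ /(_ _ ni)[_ _ /andP[h1 h2]]] := hx.
have /andP[h3 _] := fine_tagged_itv hx (ltnW ni).
have /andP[_ h4] := fine_tagged_itv hx ni.
by rewrite (le_trans h3 h1) (le_trans h2 h4).
Qed.

Lemma fine_tagged_le d d' n x xi : d <= d' -> fine_tagged d n x xi -> fine_tagged d' n x xi.
Proof.
move=> dd [x0 xn h]; split=> // i /h[h1 h2 h3]; split=> //.
exact: lt_le_trans dd.
Qed.

Lemma fine_tagged_sum d n x xi : fine_tagged d n x xi ->
  \sum_(i < n) (x i.+1 - x i) = 1.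
Proof.
move=> [x0 xn _].
by rewrite -(big_mkord xpredT (fun i => x i.+1 - x i)) telescope_sumr// xn x0 subr0.
Qed.

Lemma nrm_sum_le n (u : nat -> H) (r : nat -> R) :
  (forall i, (i < n)%N -> nrm (u i) <= r i) -> nrm (\sum_(i < n) u i) <= \sum_(i < n) r i.
Proof.
elim: n => [|n IH] h; first by rewrite !big_ord0 nrm0.
rewrite !big_ord_recr /=; apply: le_trans (nrmD _ _) _.
by rewrite lerD ?h// IH// => i ni; apply: h; exact: ltnW.
Qed.

Lemma nrm_rsum_le d n x xi g c : fine_tagged d n x xi ->
  (forall t, 0 <= t <= 1 -> nrm (g t) <= c) -> nrm (rsum n x xi g) <= c.
Proof.
move=> hx hg.
have h i : (i < n)%N -> nrm ((x i.+1 - x i)%:C *: g (xi i)) <= (x i.+1 - x i) * c.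
  move=> ni; have [_ _ /(_ _ ni)[h1 _ _]] := hx.
  rewrite nrmZ ger0_norm ?subr_ge0// ler_wpM2l ?subr_ge0//.
  by apply: hg; exact: fine_tagged_tag hx ni.
apply: le_trans (nrm_sum_le h) _.
by rewrite -mulr_suml (fine_tagged_sum hx) mul1r.
Qed.

Lemma rsumD n x xi g h : rsum n x xi (fun t => g t + h t) = rsum n x xi g + rsum n x xi h.
Proof. by rewrite /rsum -big_split; apply: eq_bigr => i _; rewrite scalerDr. Qed.

Lemma rsumB n x xi g h : rsum n x xi (fun t => g t - h t) = rsum n x xi g - rsum n x xi h.
Proof. by rewrite /rsum -sumrB; apply: eq_bigr => i _; rewrite scalerBr. Qed.

Lemma rip_rsum_ge d n x xi g c v : fine_tagged d n x xi ->
  (forall t, 0 <= t <= 1 -> c <= rip (g t) v) -> c <= rip (rsum n x xi g) v.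
Proof.
move=> hx hg.
have -> : rip (rsum n x xi g) v = \sum_(i < n) (x i.+1 - x i) * rip (g (xi i)) v.
  rewrite /rsum; elim: (n) => [|m IH]; first by rewrite !big_ord0 rip0l.
  by rewrite !big_ord_recr /= ripDl ripZl IH.
rewrite -[leLHS]mul1r -(fine_tagged_sum hx) mulr_suml; apply: ler_sum => i _.
have [_ _ /(_ _ (ltn_ord i))[h1 _ _]] := hx.
by rewrite ler_wpM2l ?subr_ge0// hg// (fine_tagged_tag hx).
Qed.

Lemma exists_uniform_partition d : 0 < d ->
  exists n, fine_tagged d n.+1 (fun i => i%:R / n.+1%:R) (fun i => i%:R / n.+1%:R).
Proof.
move=> d0; have [n /(_ n (leqnn n)) hn] := exists_invS d0; exists n.
have n0 : 0 < n.+1%:R :> R by rewrite ltr0n.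
split; [by rewrite mul0r | by rewrite divff// gt_eqF |].
move=> i ni.
have le : i%:R / n.+1%:R <= i.+1%:R / n.+1%:R :> R.
  by rewrite ler_pM2r ?invr_gt0// ler_nat.
by split; rewrite ?lexx//; rewrite -mulrBl -natr1 addrAC subrr add0r mul1r.
Qed.

(* [is_opint 0 1 F B], with the partitions given by functions instead of lists. *)
Definition riemann_limit F B := bounded_operator B /\
  forall e, 0 < e -> exists2 d, 0 < d & forall n x xi, fine_tagged d n x xi ->
    forall v, nrm (rsum n x xi (F ^~ v) - B v) <= e * nrm v.

Lemma riemann_limit_opint F B : riemann_limit F B -> is_opint 0 1 F B.
Proof.
move=> [bB h]; split=> // e e0; have e20 : 0 < e / 2 by lra.
have [d d0 hd] := h _ e20; exists d => // s xi x [xs /eqP xl] hs.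
suff hx : fine_tagged d (size s) x xi.
  apply: (@le_lt_trans _ _ (e / 2)); last by lra.
  apply: opnorm_le => [|v]; first exact: ltW.
  by have := hd _ _ _ hx v; rewrite /rsum !opE fct_sumE.
split=> [//||i si]; first by rewrite /x -(last_nth 1).
have [h1 h2] := hs i si; split=> //.
by apply: ltW; move/(pathP 1) : xs; apply.
Qed.

(** A uniform partition tagged at its left endpoints is enough to carry inequalities over to the
    integral. *)
Lemma opint_sums F B : (forall t, bounded_operator (F t)) -> is_opint 0 1 F B ->
  forall e, 0 < e -> exists d n x xi, fine_tagged d n x xi /\
    forall v, nrm (rsum n x xi (F ^~ v) - B v) <= e * nrm v.
Proof.
move=> bF [bB h] e e0; have [d d0 hd] := h e e0.
have [n hn] := exists_uniform_partition d0.
pose X (i : nat) : R := i%:R / n.+1%:R.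
pose s := mkseq (fun i => X i.+1) n.+1.
have sE i : (i <= n.+1)%N -> nth 1 (0 :: s) i = X i.
  case: i => [_|i ni]; first by rewrite /X mul0r.
  by rewrite /= /s nth_mkseq.
have [X0 X1 hX] := hn.
have ss : size s = n.+1 by rewrite size_mkseq.
exists d, n.+1, X, X; split=> // v.
have hs := hd s X; cbv zeta in hs; rewrite ss in hs.
set D := (X in opnorm X < e) in hs.
have bD : bounded_operator D.
  by apply: bounded_B => //; apply: bounded_sum => i; exact/bounded_Z.
have DE : D v = rsum n.+1 X X (F ^~ v) - B v.
  rewrite /D !opE fct_sumE; congr (_ - _); apply: eq_bigr => i _.
  by rewrite !sE// ltnW.
rewrite -DE; apply: le_trans (nrm_le_opnorm _ bD) _.
rewrite ler_wpM2r ?nrm_ge0//; apply/ltW/hs.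
  split; last by rewrite (last_nth 1) ss sE//; apply/eqP; exact: X1.
  apply/(pathP 1) => i; rewrite ss => ni.
  rewrite -[nth 1 s i]/(nth 1 (0 :: s) i.+1) !sE//; last exact: ltnW.
  by rewrite ltr_pM2r ?invr_gt0 ?ltr0n// ltr_nat.
move=> i ni; rewrite !sE//; last exact: ltnW.
by have [h1 h2 h3] := hX i ni; split.
Qed.

Lemma opint_nrm_le F B c v : (forall t, bounded_operator (F t)) -> is_opint 0 1 F B ->
  (forall t, 0 <= t <= 1 -> nrm (F t v) <= c) -> nrm (B v) <= c.
Proof.
move=> bF iF hc; apply: (@le_eps_mul _ _ _ (nrm v)); first exact: nrm_ge0.
move=> e e0; have [d [n [x [xi [hx /(_ v) h]]]]] := opint_sums bF iF e0.
have -> : B v = rsum n x xi (F ^~ v) - (rsum n x xi (F ^~ v) - B v).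
  by rewrite opprB addrC subrK.
apply: le_trans (nrmD _ _) _; rewrite nrmN lerD//.
exact: nrm_rsum_le hx _.
Qed.

Lemma opint_rip_ge F B c v : (forall t, bounded_operator (F t)) -> is_opint 0 1 F B ->
  (forall t, 0 <= t <= 1 -> c <= rip (F t v) v) -> c <= rip (B v) v.
Proof.
move=> bF iF hc; apply: (@le_eps_mul _ _ _ (nrm v ^+ 2)); first exact: sqr_ge0.
move=> e e0; have [d [n [x [xi [hx /(_ v) h]]]]] := opint_sums bF iF e0.
have := rip_rsum_ge hx hc.
have : `|rip (rsum n x xi (F ^~ v) - B v) v| <= e * nrm v ^+ 2.
  by apply: le_trans (rip_le _ _) _; rewrite expr2 mulrA ler_wpM2r ?nrm_ge0.
by rewrite ripBl ler_norml => /andP[]; lra.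
Qed.

Lemma riemann_limitD F G B C : riemann_limit F B -> riemann_limit G C ->
  riemann_limit (fun t => F t + G t) (B + C).
Proof.
move=> [bB hB] [bC hC]; split=> [|e e0]; first exact: bounded_D.
have e20 : 0 < e / 2 by lra.
have [d1 d10 h1] := hB _ e20; have [d2 d20 h2] := hC _ e20.
exists (Num.min d1 d2) => [|n x xi hx v]; first by rewrite lt_min d10 d20.
have hx1 : fine_tagged d1 n x xi by apply: fine_tagged_le hx; rewrite ge_min lexx.
have hx2 : fine_tagged d2 n x xi by apply: fine_tagged_le hx; rewrite ge_min lexx orbT.
rewrite (rsumD n x xi (F ^~ v) (G ^~ v)) opE opprD addrACA.
apply: le_trans (nrmD _ _) _.
by have := h1 _ _ _ hx1 v; have := h2 _ _ _ hx2 v; lra.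
Qed.

(** Both terms lie between [(k + 1) (z - y) y^k] and [(k + 1) (z - y) z^k], and these bounds differ
    by an amount quadratic in [z - y]. *)
Lemma expr_increment_bound k (y z t : R) : 0 <= y -> y <= t -> t <= z -> z <= 1 ->
  `|(z ^+ k.+1 - y ^+ k.+1) - k.+1%:R * (z - y) * t ^+ k| <= k.+1%:R ^+ 2 * (z - y) ^+ 2.
Proof.
move=> y0 yt tz z1.
have z0 : 0 <= z by lra. have t0 : 0 <= t by lra.
have yt_k m : y ^+ m <= t ^+ m by rewrite lerXn2r ?nnegrE.
have tz_k m : t ^+ m <= z ^+ m by rewrite lerXn2r ?nnegrE.
have up m : z ^+ m.+1 - y ^+ m.+1 <= m.+1%:R * (z - y) * z ^+ m.
  elim: m => [|m IH]; first by rewrite !expr1 expr0 mul1r mulr1.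
  have -> : z ^+ m.+2 - y ^+ m.+2 = z * (z ^+ m.+1 - y ^+ m.+1) + (z - y) * y ^+ m.+1.
    by rewrite !(exprS _ m.+1); ring.
  have h1 := ler_wpM2l z0 IH.
  have h2 : (z - y) * y ^+ m.+1 <= (z - y) * z ^+ m.+1.
    by apply: ler_wpM2l; [lra|exact: le_trans (yt_k _) (tz_k _)].
  have -> : m.+2%:R * (z - y) * z ^+ m.+1
      = z * (m.+1%:R * (z - y) * z ^+ m) + (z - y) * z ^+ m.+1.
    by rewrite -[m.+2%:R]natr1 (exprS z m); ring.
  exact: lerD.
have lo m : m.+1%:R * (z - y) * y ^+ m <= z ^+ m.+1 - y ^+ m.+1.
  elim: m => [|m IH]; first by rewrite !expr1 expr0 mul1r mulr1.
  have -> : z ^+ m.+2 - y ^+ m.+2 = y * (z ^+ m.+1 - y ^+ m.+1) + (z - y) * z ^+ m.+1.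
    by rewrite !(exprS _ m.+1); ring.
  have h1 := ler_wpM2l y0 IH.
  have h2 : (z - y) * y ^+ m.+1 <= (z - y) * z ^+ m.+1.
    by apply: ler_wpM2l; [lra|exact: le_trans (yt_k _) (tz_k _)].
  have -> : m.+2%:R * (z - y) * y ^+ m.+1
      = y * (m.+1%:R * (z - y) * y ^+ m) + (z - y) * y ^+ m.+1.
    by rewrite -[m.+2%:R]natr1 (exprS y m); ring.
  exact: lerD.
have k0 : 0 <= k.+1%:R * (z - y) by rewrite mulr_ge0//; lra.
have gap : z ^+ k - y ^+ k <= k.+1%:R * (z - y).
  case: k {k0} => [|k]; first by rewrite !expr0 subrr mulr_ge0//; lra.
  apply: le_trans (up k) _; apply: (@le_trans _ _ (k.+1%:R * (z - y) * 1)).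
    by rewrite ler_wpM2l ?mulr_ge0 ?exprn_ile1//; lra.
  by rewrite mulr1 ler_wpM2r ?ler_nat//; lra.
have -> : k.+1%:R ^+ 2 * (z - y) ^+ 2 = k.+1%:R * (z - y) * (k.+1%:R * (z - y)).
  by ring.
apply: le_trans _ (ler_wpM2l k0 gap).
have h1 := ler_wpM2l k0 (yt_k k); have h2 := ler_wpM2l k0 (tz_k k).
have := up k; have := lo k; rewrite mulrBr ler_norml => h3 h4.
by apply/andP; split; lra.
Qed.

Lemma riemann_limit_monomial k C : bounded_operator C ->
  riemann_limit (fun t => (t ^+ k)%:C *: C) ((k.+1%:R^-1)%:C *: C).
Proof.
move=> bC; split=> [|e e0]; first exact: bounded_Z.
have [M M0 [hM _]] := bounded_rip bC.
have k0 : 0 < k.+1%:R :> R by rewrite ltr0n.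
have kM : 0 < k.+1%:R * M by rewrite mulr_gt0.
(* On an interval of length [r] the error is at most [r ^+ 2 * (k.+1%:R * M) * nrm v], so this mesh
   leaves [r * (e * nrm v)], and the lengths add up to [1]. *)
exists (e / (k.+1%:R * M)) => [|n x xi hx v]; first exact: divr_gt0.
have [x0 xn hi] := hx.
(* The integral is written as a telescoping sum of increments of the primitive, to be compared with
   the Riemann sum term by term. *)
have -> : (k.+1%:R^-1%:C *: C) v
    = \sum_(i < n) (k.+1%:R^-1 * (x i.+1 ^+ k.+1 - x i ^+ k.+1))%:C *: C v.
  rewrite -scaler_suml -rmorph_sum -mulr_sumr.
  rewrite -(big_mkord xpredT (fun i => x i.+1 ^+ k.+1 - x i ^+ k.+1)).
  by rewrite (telescope_sumr (fun i => x i ^+ k.+1))// x0 xn expr1n expr0n subr0 mulr1.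
rewrite /rsum -sumrB.
suff h i : (i < n)%N ->
    nrm ((x i.+1 - x i)%:C *: ((xi i ^+ k)%:C *: C) v
         - (k.+1%:R^-1 * (x i.+1 ^+ k.+1 - x i ^+ k.+1))%:C *: C v)
    <= (x i.+1 - x i) * (e * nrm v).
  apply: le_trans (nrm_sum_le h) _.
  by rewrite -mulr_suml (fine_tagged_sum hx) mul1r.
move=> ni; have [h1 h2 /andP[h3 h4]] := hi i ni.
have /andP[xi0 _] := fine_tagged_itv hx (ltnW ni).
have /andP[_ xi1] := fine_tagged_itv hx ni.
rewrite opE scalerA -rmorphM -scalerBl -rmorphB nrmZ.
have -> : (x i.+1 - x i) * xi i ^+ k - k.+1%:R^-1 * (x i.+1 ^+ k.+1 - x i ^+ k.+1)
    = - (k.+1%:R^-1 * ((x i.+1 ^+ k.+1 - x i ^+ k.+1) - k.+1%:R * (x i.+1 - x i) * xi i ^+ k)).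
  by field; rewrite gt_eqF.
rewrite normrN normrM (ger0_norm (ltW _)) ?invr_gt0//.
have inc := expr_increment_bound k xi0 h3 h4 xi1.
apply: (@le_trans _ _ (k.+1%:R^-1 * (k.+1%:R ^+ 2 * (x i.+1 - x i) ^+ 2) * (M * nrm v))).
  apply: ler_pM; rewrite ?mulr_ge0 ?invr_ge0 ?nrm_ge0 ?(ltW k0)//.
  by rewrite ler_wpM2l ?invr_ge0 ?(ltW k0).
have -> : k.+1%:R^-1 * (k.+1%:R ^+ 2 * (x i.+1 - x i) ^+ 2) * (M * nrm v)
    = (x i.+1 - x i) * ((x i.+1 - x i) * (k.+1%:R * M) * nrm v).
  by field; rewrite gt_eqF.
rewrite ler_wpM2l ?subr_ge0// ler_wpM2r ?nrm_ge0//.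
by rewrite -ler_pdivlMr// ltW.
Qed.

End RiemannSums.
(** * Integrals of operator-valued functions *)

Section OperatorIntegrals.
Context {R : realType} {H : hilbertType R}.
Implicit Types (v w : H) (a b c d e t : R) (F G : R -> H -> H) (B C D S T : H -> H).
Implicit Types (n k : nat) (x xi : nat -> R) (f : R -> R) (p : {poly R}).

(** Comparing Riemann sums on one fine partition shows that the integrals of the approximants are
    Cauchy; their limit is the integral of [F]. *)
Lemma riemann_limit_uniform F :
  (forall e, 0 < e -> exists G B, riemann_limit G B /\
     forall t, 0 <= t <= 1 -> forall v, nrm (F t v - G t v) <= e * nrm v) ->
  exists B, riemann_limit F B.
Proof.
move=> hF.
have /choice[GB hGB] : forall n, exists GB : (R -> H -> H) * (H -> H),
    riemann_limit GB.1 GB.2 /\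
    forall t, 0 <= t <= 1 -> forall v, nrm (F t v - GB.1 t v) <= n.+1%:R^-1 * nrm v.
  move=> n; have n0 : 0 < n.+1%:R^-1 :> R by rewrite invr_gt0.
  by have [G [B hB]] := hF _ n0; exists (G, B).
pose r n : R := n.+1%:R^-1.
have sumF d n m x xi v : fine_tagged d n x xi ->
    nrm (rsum n x xi (F ^~ v) - rsum n x xi ((GB m).1 ^~ v)) <= r m * nrm v.
  move=> hx; rewrite -rsumB; apply: nrm_rsum_le hx _ => t t01.
  exact: (hGB m).2.
have BB m n v : nrm ((GB m).2 v - (GB n).2 v) <= (r m + r n) * nrm v.
  apply: (@le_eps_mul _ _ _ (2 * nrm v)); first by rewrite mulr_ge0 ?nrm_ge0.
  move=> e e0; have [[_ /(_ e e0)[d1 d10 h1]] _] := hGB m.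
  have [[_ /(_ e e0)[d2 d20 h2]] _] := hGB n.
  have d0 : 0 < Num.min d1 d2 by rewrite lt_min d10 d20.
  have [N hN] := exists_uniform_partition d0; set X := (fun i : nat => _) in hN.
  have hx1 : fine_tagged d1 N.+1 X X by apply: fine_tagged_le hN; rewrite ge_min lexx.
  have hx2 : fine_tagged d2 N.+1 X X by apply: fine_tagged_le hN; rewrite ge_min lexx orbT.
  have := h1 _ _ _ hx1 v; have := h2 _ _ _ hx2 v.
  have := sumF _ _ m _ _ v hN; have := sumF _ _ n _ _ v hN.
  set Sm := rsum _ _ _ ((GB m).1 ^~ v); set Sn := rsum _ _ _ ((GB n).1 ^~ v).
  set SF := rsum _ _ _ (F ^~ v).
  have := nrm_sub_trans ((GB m).2 v) Sm ((GB n).2 v).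
  have := nrm_sub_trans Sm SF ((GB n).2 v).
  have := nrm_sub_trans SF Sn ((GB n).2 v).
  rewrite (nrmB ((GB m).2 v) Sm) (nrmB Sm SF); lra.
have [||B bB hB] := @operator_complete _ _ (fun n => (GB n).2).
- by move=> n; have [[]] := hGB n.
- move=> e e0; have e20 : 0 < e / 2 by lra.
  have [N hN] := exists_invS e20; exists N => m n Nm Nn v.
  apply: le_trans (BB m n v) _; rewrite ler_wpM2r ?nrm_ge0//.
  by have := hN m Nm; have := hN n Nn; rewrite -/(r m) -/(r n); lra.
exists B; split=> // e e0; have e30 : 0 < e / 3 by lra.
have [N hN] := hB _ e30; have [M hM] := exists_invS e30.
pose m := maxn N M.
have [[_ /(_ _ e30)[d d0 hd]] _] := hGB m.
exists d => // n x xi hx v.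
have := sumF _ _ m _ _ v hx; have := hd _ _ _ hx v.
have := hN m (leq_maxl _ _) v; have rm : r m <= e / 3 by exact/ltW/hM/leq_maxr.
have := ler_wpM2r (nrm_ge0 v) rm.
have := nrm_sub_trans (rsum n x xi (F ^~ v)) (rsum n x xi ((GB m).1 ^~ v)) (B v).
have := nrm_sub_trans (rsum n x xi ((GB m).1 ^~ v)) ((GB m).2 v) (B v).
lra.
Qed.

(** Polynomials in [t] with bounded operators as coefficients, built term by term so that
    integrability follows by induction. *)
Inductive operator_poly : (R -> H -> H) -> Prop :=
| Operator_poly0 : operator_poly (fun=> 0)
| Operator_polyD k C F of bounded_operator C & operator_poly F :
    operator_poly (fun t => F t + (t ^+ k)%:C *: C).

Lemma operator_poly_sum F G : operator_poly F -> operator_poly G ->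
  operator_poly (fun t => F t + G t).
Proof.
move=> hF; elim=> [|k C G' bC _ IH].
  by rewrite (_ : (fun t => _) = F)//; apply/funext => t; rewrite addr0.
rewrite (_ : (fun t => _) = (fun t => (F t + G' t) + (t ^+ k)%:C *: C)).
  exact: Operator_polyD.
by apply/funext => t; rewrite addrA.
Qed.

Lemma operator_poly_comp D F : bounded_operator D -> operator_poly F ->
  operator_poly (fun t => D \o F t).
Proof.
move=> bD; have lD := bounded_lin bD; elim=> [|k C G bC _ IH].
  rewrite (_ : (fun t => _) = (fun=> 0)); first exact: Operator_poly0.
  by apply/funext => t; apply/funext => v; exact: lin0.
rewrite (_ : (fun t => _) = (fun t => (D \o G t) + (t ^+ k)%:C *: (D \o C))).
  by apply: Operator_polyD => //; exact: bounded_comp.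
by apply/funext => t; apply/funext => v; rewrite !opE (linD _ _ lD) (linZ _ _ lD).
Qed.

Lemma operator_poly_scale F : operator_poly F -> operator_poly (fun t => t%:C *: F t).
Proof.
elim=> [|k C G bC _ IH].
  rewrite (_ : (fun t => _) = (fun=> 0)); first exact: Operator_poly0.
  by apply/funext => t; rewrite scaler0.
rewrite (_ : (fun t => _) = (fun t => t%:C *: G t + (t ^+ k.+1)%:C *: C)).
  exact: Operator_polyD.
by apply/funext => t; rewrite scalerDr scalerA -rmorphM -exprS.
Qed.

Lemma operator_poly_const C : bounded_operator C -> operator_poly (fun=> C).
Proof.
move=> bC; rewrite (_ : (fun t => _) = (fun t => 0 + (t ^+ 0)%:C *: C)).
  by apply: Operator_polyD => //; exact: Operator_poly0.
by apply/funext => t; rewrite add0r expr0 scale1r.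
Qed.

(** Horner's scheme: [oppoly_comm] moves the new factor [S + t T] to the left, where composing with
    [S] and [T] preserves [operator_poly] even if they do not commute. *)
Lemma operator_poly_oppoly p S T : bounded_operator S -> bounded_operator T ->
  operator_poly (fun t => oppoly p (S + t%:C *: T)).
Proof.
move=> bS bT; have lST t : linear (S + t%:C *: T).
  by apply: bounded_lin; apply: bounded_D => //; exact: bounded_Z.
elim/poly_ind: p => [|p c IH].
  rewrite (_ : (fun t => _) = (fun=> 0)); first exact: Operator_poly0.
  by apply/funext => t; apply/funext => v; rewrite -polyC0 oppolyC scale0r.
rewrite (_ : (fun t => _) = (fun t => ((S \o oppoly p (S + t%:C *: T))
    + t%:C *: (T \o oppoly p (S + t%:C *: T))) + c%:C *: idfun)).
  apply: operator_poly_sum; last exact/operator_poly_const/bounded_Z/bounded_id.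
  apply: operator_poly_sum; first exact: operator_poly_comp.
  exact/operator_poly_scale/operator_poly_comp.
apply/funext => t; apply/funext => v.
by rewrite oppolyD oppolyMX oppolyC (oppoly_comm _ _ (lST t)).
Qed.

Lemma operator_poly_riemann F : operator_poly F -> exists B, riemann_limit F B.
Proof.
elim=> [|k C G bC _ [B hB]].
  exists 0; split=> [|e e0]; first exact: bounded_0.
  exists 1 => // n x xi _ v.
  rewrite /rsum big1 => [|i _]; last by rewrite scaler0.
  by rewrite subr0 nrm0 mulr_ge0 ?nrm_ge0// ltW.
exists (B + (k.+1%:R^-1)%:C *: C).
exact: riemann_limitD hB (riemann_limit_monomial k bC).
Qed.

(** * Operator convexity on positive operators and on scalars *)

Lemma cfc_bounded f T : bounded_operator (cfc f T).
Proof.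
rewrite /cfc; case: xgetP => [B _ []//|_]; exact: bounded_0.
Qed.

Lemma spectrum_subset T : selfadjoint T -> rpos T ->
  spectrum T `<=` [set x%:C | x in [set` `[0, +oo[%R]].
Proof.
move=> sT pT z sz; have zE := spectrum_real sT sz; rewrite zE in sz *.
by exists (complex.Re z) => //=; rewrite in_itv /= (rpos_spectrum sT pT sz).
Qed.

Lemma scalar_selfadjoint c : selfadjoint (c%:C *: idfun : H -> H).
Proof.
apply/selfadjointP; split; first exact/bounded_Z/bounded_id.
by move=> v w; rewrite !opE ripZl ripZr.
Qed.

Lemma scalar_rpos c : 0 <= c -> rpos (c%:C *: idfun : H -> H).
Proof. by move=> c0 v; rewrite !opE ripZl -nrm_sqr mulr_ge0 ?sqr_ge0. Qed.

(** The spectrum of [c I] is contained in [{c}], where [f] agrees with the constant polynomial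
    [f c]. *)
Lemma rip_cfc_scalar f c v : 0 <= c -> {within `[0, +oo[, continuous f} ->
  rip (cfc f (c%:C *: idfun) v) v = f c * nrm v ^+ 2.
Proof.
move=> c0 cf; have sc := scalar_selfadjoint c; have pc := scalar_rpos c0.
have hB := cfc_spec sc pc cf.
have spec a : spectrum (c%:C *: idfun : H -> H) a%:C -> a = c.
  have e (w : H) : rip ((c%:C *: idfun : H -> H) w) w = c * nrm w ^+ 2.
    by rewrite !opE ripZl -nrm_sqr.
  move=> sa; apply/eqP; rewrite eq_le.
  by rewrite (spectrum_le sc _ sa) ?(spectrum_ge sc _ sa)// => w; rewrite e.
have := @is_cfc_le _ _ _ _ _ (f c)%:P sc hB _ v.
have := @is_cfc_ge _ _ _ _ _ (f c)%:P sc hB _ v.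
rewrite oppolyC ripZl -nrm_sqr => h1 h2; apply/eqP; rewrite eq_le h1 ?h2//.
  by move=> a /spec ->; rewrite hornerC.
by move=> a /spec ->; rewrite hornerC.
Qed.

Lemma operator_convex_rip f S T t v : operator_convex (H := H) `[0, +oo[ f ->
  selfadjoint S -> rpos S -> selfadjoint T -> rpos T -> 0 <= t <= 1 ->
  rip (cfc f ((1 - t)%:C *: S + t%:C *: T) v) v
    <= (1 - t) * rip (cfc f S v) v + t * rip (cfc f T v) v.
Proof.
move=> [_ h] sS pS sT pT t01.
have := h S T sS sT (spectrum_subset sS pS) (spectrum_subset sT pT) t t01 v.
rewrite lecE => /andP[_]; rewrite -/(rip _ _) !opE !ripE.
by rewrite subr_ge0.
Qed.

(** Operator convexity at multiples of the identity, evaluated at a nonzero vector. *)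
Lemma operator_convex_convex f a b t v : v != 0 -> operator_convex (H := H) `[0, +oo[ f ->
  0 <= a -> 0 <= b -> 0 <= t <= 1 ->
  f ((1 - t) * a + t * b) <= (1 - t) * f a + t * f b.
Proof.
move=> v0 hf a0 b0 t01.
have := operator_convex_rip v hf (scalar_selfadjoint a) (scalar_rpos a0)
  (scalar_selfadjoint b) (scalar_rpos b0) t01.
have ab0 : 0 <= (1 - t) * a + t * b.
  by case/andP: t01 => ? ?; rewrite addr_ge0 ?mulr_ge0 ?subr_ge0.
have cf := hf.1.
rewrite !scalerA -!rmorphM -scalerDl -rmorphD !rip_cfc_scalar//.
move=> h; rewrite -(ler_pM2r (exprn_gt0 2 (nrm_gt0 v0))); lra.
Qed.

End OperatorIntegrals.

(** * Supporting lines and suprema of real functions *)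

(** The slope is the supremum of the slopes of the chords to the left of [s], each of which is at
    most every slope to the right. At [s = 0] there is no left side, and monotonicity allows slope
    [0]. *)
Lemma supporting_line {R : realType} (f : R -> R) (s : R) :
  (forall a b t, 0 <= a -> 0 <= b -> 0 <= t <= 1 ->
     f ((1 - t) * a + t * b) <= (1 - t) * f a + t * f b) ->
  (forall x y, 0 <= x -> x <= y -> f x <= f y) -> 0 <= s ->
  exists k, forall u, 0 <= u -> f s + k * (u - s) <= f u.
Proof.
move=> fc fi; rewrite le_eqVlt => /orP[/eqP <-|s0].
  by exists 0 => u u0; rewrite mul0r addr0 fi.
have slopes u v : 0 <= u -> u < s -> s < v -> (f s - f u) / (s - u) <= (f v - f s) / (v - s).
  move=> u0 us sv.
  have uv : 0 < v - u by lra.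
  have t01 : 0 <= (s - u) / (v - u) <= 1.
    rewrite divr_ge0 ?ler_pdivrMr//=; lra.
  have v0 : 0 <= v by lra.
  have := fc u v _ u0 v0 t01.
  have -> : (1 - (s - u) / (v - u)) * u + (s - u) / (v - u) * v = s.
    by field; rewrite gt_eqF.
  have -> : (1 - (s - u) / (v - u)) * f u + (s - u) / (v - u) * f v
      = ((v - s) * f u + (s - u) * f v) / (v - u).
    by field; rewrite gt_eqF.
  rewrite ler_pdivlMr// => h.
  rewrite ler_pdivrMr ?subr_gt0// mulrAC ler_pdivlMr ?subr_gt0//; lra.
pose E := [set (f s - f u) / (s - u) | u in [set u | 0 <= u < s]].
have E0 : E !=set0 by exists ((f s - f 0) / (s - 0)), 0 => //=; rewrite lexx.
have Eub v : s < v -> ubound E ((f v - f s) / (v - s)).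
  by move=> sv _ [u /= /andP[u0 us] <-]; exact: slopes.
have hE : has_sup E by split=> //; exists ((f (s + 1) - f s) / (s + 1 - s)); apply: Eub; lra.
exists (sup E) => u u0; have [us|us|->] := ltgtP u s.
- have : (f s - f u) / (s - u) <= sup E.
    by apply: (sup_ubound hE.2); exists u => //=; rewrite u0.
  by rewrite ler_pdivrMr ?subr_gt0//; lra.
- have : sup E <= (f u - f s) / (u - s) by apply: ge_sup => //; exact: Eub.
  by rewrite ler_pdivlMr ?subr_gt0//; lra.
- by rewrite subrr mulr0 addr0.
Qed.

Lemma le_sup_sqr {R : realType} (f : R -> R) (N : set R) (c : R) :
  {within `[0, +oo[, continuous f} -> has_sup N -> (forall r, N r -> 0 <= r) ->
  (forall r, N r -> f (r ^+ 2) <= c) -> f (sup N ^+ 2) <= c.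
Proof.
move=> cf hN N0 hc.
have s0 : 0 <= sup N.
  by have [[r Nr] _] := hN; apply: le_trans (N0 r Nr) _; exact: sup_ubound hN.2 _ Nr.
apply/ler_addgt0Pr => e e0.
have sI : `[0, +oo[%classic (sup N ^+ 2) by rewrite /= in_itv /= sqr_ge0.
have [d d0 hd] := within_continuous_dist cf sI e0.
have k0 : 0 < 2 * sup N + 1 by rewrite ltr_wpDl// mulr_ge0.
(* Since [sup N + r] is below [2 * sup N + 1], this closeness puts the squares within [d] of each
   other. *)
have [r Nr hr] := sup_adherent (divr_gt0 d0 k0) hN.
have r0 := N0 r Nr; have rs := sup_ubound hN.2 Nr.
have rI : `[0, +oo[%classic (r ^+ 2) by rewrite /= in_itv /= sqr_ge0.
have : `|sup N ^+ 2 - r ^+ 2| < d.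
  rewrite subr_sqr normrM !ger0_norm ?subr_ge0 ?addr_ge0//.
  apply: (@le_lt_trans _ _ ((sup N - r) * (2 * sup N + 1))).
    by rewrite ler_wpM2l ?subr_ge0//; lra.
  by rewrite -ltr_pdivlMr//; lra.
move=> /(hd _ rI); have := hc r Nr; rewrite ltr_norml => h1 /andP[]; lra.
Qed.
(** * Jensen's inequality along the segment from X to c I *)

Section Segment.
Context {R : realType} {H : hilbertType R}.
Variables (f : R -> R) (X : H -> H) (c : R).
Hypothesis f_conv : operator_convex (H := H) `[0, +oo[ f.
Hypothesis f_ge0 : forall x, 0 <= x -> 0 <= f x.
Hypothesis f_incr : forall x y, 0 <= x -> x <= y -> f x <= f y.
Hypothesis sX : selfadjoint X.
Hypothesis pX : rpos X.
Hypothesis c0 : 0 <= c.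
Implicit Types (t e : R) (v x : H).

Let Y t : H -> H := (1 - t)%:C *: X + (t * c)%:C *: idfun.

Let ripY t x : rip (Y t x) x = (1 - t) * rip (X x) x + t * c * nrm x ^+ 2.
Proof. by rewrite /Y !opE !ripE -nrm_sqr. Qed.

Lemma segment_selfadjoint t : selfadjoint (Y t).
Proof.
have [bX symX] := (selfadjointP X).1 sX; apply/selfadjointP; split.
  by apply: bounded_D; apply: bounded_Z => //; exact: bounded_id.
by move=> v w; rewrite /Y !opE !ripE symX.
Qed.

Lemma segment_rpos t : 0 <= t <= 1 -> rpos (Y t).
Proof.
move=> /andP[t0 t1] x; rewrite ripY; apply: addr_ge0.
  by apply: mulr_ge0 (pX x); rewrite subr_ge0.
exact: mulr_ge0 (mulr_ge0 t0 c0) (sqr_ge0 _).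
Qed.

Lemma segment_cfc t : 0 <= t <= 1 -> is_cfc f (Y t) (cfc f (Y t)).
Proof.
by move=> t01; apply: cfc_spec f_conv.1; [exact: segment_selfadjoint|exact: segment_rpos].
Qed.

(** The spectra of all [Y t] lie in [[0, K + c]], where a single polynomial [p] approximates [f]. As
    [Y t] is affine in [t], [p(Y t)] is an operator polynomial in [t]. *)
Lemma segment_opint : is_opint 0 1 (fun t => cfc f (Y t)) (opint 0 1 (fun t => cfc f (Y t))).
Proof.
suff [B hB] : exists B, riemann_limit (fun t => cfc f (Y t)) B.
  apply: (@xgetPex _ 0 (is_opint 0 1 (fun t => cfc f (Y t)))).
  by exists B; exact: riemann_limit_opint.
apply: riemann_limit_uniform => e e0.
have [K K0 [_ hK]] := bounded_rip sX.1.
have Kc : 0 < K + c by rewrite ltr_pwDl.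
have [|p hp] := weierstrass Kc (f := f) _ e0.
  apply: continuous_subspaceW f_conv.1 => x /=.
  by rewrite !in_itv /= andbT => /andP[].
have bW : bounded_operator (c%:C *: idfun - X).
  by apply: bounded_B sX.1; exact/bounded_Z/bounded_id.
have [B hB] := operator_poly_riemann (operator_poly_oppoly p sX.1 bW).
exists (fun t => oppoly p (X + t%:C *: (c%:C *: idfun - X))), B; split=> // t t01 v.
have -> : X + t%:C *: (c%:C *: idfun - X) = Y t.
  apply/funext => x; rewrite /Y !opE rmorphB rmorph1 rmorphM scalerBl scale1r.
  by rewrite scalerBr scalerA addrA addrAC.
rewrite nrmB; apply: is_cfc_approx (segment_cfc t01) (ltW e0) _ v.
  exact: segment_selfadjoint.
move=> a sa; apply: hp.
rewrite (rpos_spectrum (segment_selfadjoint t) (segment_rpos t01) sa) /=.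
apply: (spectrum_le (segment_selfadjoint t) _ sa) => x; rewrite ripY.
have := hK x; have := pX x; have := sqr_ge0 (nrm x); case/andP: t01 => t0 t1.
move: (nrm x ^+ 2) (rip (X x) x) => n r n0 r0 rK.
have h1 : (1 - t) * r <= 1 * r by apply: ler_wpM2r => //; lra.
have h2 : t * (c * n) <= 1 * (c * n) by apply: ler_wpM2r => //; rewrite mulr_ge0.
lra.
Qed.

(** The supporting line of [f] at [s = rip (Y t x) x] is an affine polynomial below [f] on the
    spectrum, and the form at [x] of this polynomial in [Y t] is exactly [f s]. *)
Lemma segment_jensen t x : 0 <= t <= 1 -> nrm x = 1 ->
  f ((1 - t) * rip (X x) x + t * c) <= rip (cfc f (Y t) x) x.
Proof.
move=> t01 x1; pose s := rip (Y t x) x.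
have sE : (1 - t) * rip (X x) x + t * c = s by rewrite /s ripY x1 expr1n mulr1.
have x0 : x != 0 by rewrite -nrm_eq0 x1 oner_eq0.
have s0 : 0 <= s := segment_rpos t01 x.
have [k hk] := supporting_line
  (fun a b t => @operator_convex_convex R H f a b t x x0 f_conv) f_incr s0.
have := is_cfc_ge (q := (f s - k * s)%:P + k *: 'X) (segment_selfadjoint t)
  (segment_cfc t01) _ x.
rewrite oppolyD oppolyC oppolyZ oppolyX ripDl !ripZl -nrm_sqr x1 expr1n mulr1.
rewrite -/s subrK sE; apply => a sa.
rewrite !hornerE.
by have := hk a (rpos_spectrum (segment_selfadjoint t) (segment_rpos t01) sa); lra.
Qed.

(** Since [f (Y t)] is positive, bounding its form is enough. Operator convexity does so, and the
    hypothesis on [f c] absorbs the scalar endpoint. *)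
Lemma segment_nrm_le t x : 0 <= t <= 1 -> f c <= opnorm (cfc f X) ->
  nrm (cfc f (Y t) x) <= opnorm (cfc f X) * nrm x.
Proof.
move=> t01 fc; have sY := segment_selfadjoint t; have pY := segment_rpos t01.
have hB := segment_cfc t01.
have [bB rB] := (selfadjointP _).1 (is_cfc_selfadjoint sY hB).
apply: rpos_nrm_le => //; first exact: bounded_lin.
- move=> v; have := @is_cfc_ge _ _ _ _ _ 0 sY hB _ v.
  rewrite -polyC0 oppolyC scale0r rip0l; apply => a sa.
  by rewrite hornerC f_ge0// (rpos_spectrum sY pY sa).
- move=> v.
  have := operator_convex_rip v f_conv sX pX (scalar_selfadjoint c) (scalar_rpos c0) t01.
  rewrite scalerA -rmorphM rip_cfc_scalar//; last exact: f_conv.1.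
  move/le_trans; apply.
  have h1 : rip (cfc f X v) v <= opnorm (cfc f X) * nrm v ^+ 2.
    apply: le_trans (ler_norm _) _; apply: le_trans (rip_le _ _) _.
    rewrite expr2 mulrA ler_wpM2r ?nrm_ge0//; apply: nrm_le_opnorm.
    exact: cfc_bounded.
  have h2 := ler_wpM2r (sqr_ge0 (nrm v)) fc.
  case/andP: t01 => t0 t1; have t1' : 0 <= 1 - t by lra.
  have h3 := ler_wpM2l t1' h1; have h4 := ler_wpM2l t0 h2; lra.
- by apply: opnorm_ge0; exact: cfc_bounded.
Qed.

End Segment.

(** * The numerical radius *)

Section NumericalRadius.
Context {R : realType} {H : hilbertType R}.
Variable A : H -> H.
Hypothesis bA : bounded_operator A.
Implicit Types x : H.
Let Q := opabs (adjoint A).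
Let M : H -> H := 2^-1 *: (opabs A + Q).

(** A rotation of [x] turns the modulus of an inner product into a real part, to which the real
    inequalities apply. *)
Lemma inner_phase (u x : H) : exists2 z : R[i], `|z| = 1 &
  rip u (z *: x) = complex.Re `|inner u x|.
Proof.
set w := inner u x; have [w0|w0] := eqVneq w 0.
  by exists 1; rewrite ?normr1// scale1r /rip -/w w0 normr0.
pose n := complex.Re `|w|.
have nE : `|w| = n%:C by rewrite /n RRe_real ?normr_real.
have n0 : n != 0 by rewrite -(inj_eq RC_inj) -nE normr_eq0.
(* The phase is [w / |w|] without conjugation, because the inner product is conjugate-linear in its
   second argument. *)
exists ((n^-1)%:C * w).
  by rewrite normrM nE normc_def /= expr0n addr0 sqrtr_sqr -rmorphM ger0_norm
    ?invr_ge0 ?mulVf// -ler0c -nE normr_ge0.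
rewrite -scalerA ripZr /rip innerZr -/w [Num.conj w * w]mulrC -normCK -/n nE.
by rewrite -rmorphXn /= expr2 mulKf.
Qed.

Lemma rip_phase (T : H -> H) (z : R[i]) x : linear T -> `|z| = 1 ->
  rip (T (z *: x)) (z *: x) = rip (T x) x.
Proof.
move=> lT z1; rewrite (linZ _ _ lT) /rip innerZl innerZr mulrA -normCK z1.
by rewrite expr1n mul1r.
Qed.

Lemma inner_le_mean x : complex.Re `|inner (A x) x| <= rip (M x) x.
Proof.
have [sP pP _] := opabsP bA; have [sQ pQ _] := opabs_adjointP bA.
have [z z1 <-] := inner_phase (A x) x.
have -> : rip (M x) x = (rip (opabs A x) x + rip (Q x) x) / 2.
  have -> : M x = (2^-1)%:C *: (opabs A x + Q x).
    by rewrite /M !opE fmorphV rmorphMn rmorph1.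
  by rewrite !ripE mulrC.
have := mixed_schwarz bA x (z *: x); rewrite (rip_phase _ (bounded_lin sQ.1) z1) -/Q => h.
have p0 := pP x; have q0 := pQ x; rewrite -/Q in q0.
have m0 : 0 <= (rip (opabs A x) x + rip (Q x) x) / 2.
  by rewrite divr_ge0// addr_ge0.
apply: le_trans (ler_norm _) _.
rewrite -ler_sqr ?nnegrE// real_normK ?num_real//; apply: le_trans h _.
rewrite -subr_ge0; move: (rip (opabs A x) x) (rip (Q x) x) => p q.
have -> : ((p + q) / 2) ^+ 2 - p * q = ((p - q) / 2) ^+ 2 by field.
exact: sqr_ge0.
Qed.

Lemma inner_le_opabs_adjoint x : nrm x = 1 -> complex.Re `|inner (A x) x| <= nrm (Q x).
Proof.
move=> x1; have [z z1 <-] := inner_phase (A x) x.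
rewrite (nrm_opabs_adjoint bA).
have -> : rip (A x) (z *: x) = rip x (adjoint A (z *: x)).
  by rewrite /rip (adjointP bA).
apply: le_trans (ler_norm _) _; apply: le_trans (rip_le _ _) _.
rewrite x1 mul1r (linZ _ _ (bounded_lin (adjoint_bounded bA))) nrmZc z1.
by rewrite mul1r.
Qed.

Variable alpha : R.
Hypothesis alpha01 : 0 <= alpha <= 1.
Let X : H -> H := alpha%:C *: (M \o M) + (1 - alpha)%:C *: (Q \o Q).

Lemma mean_selfadjoint : selfadjoint M.
Proof.
have [sP _ _] := opabsP bA; have [sQ _ _] := opabs_adjointP bA.
have [bP rP] := (selfadjointP _).1 sP; have [bQ rQ] := (selfadjointP _).1 sQ.
have -> : M = (2^-1)%:C *: (opabs A + Q).
  by rewrite /M fmorphV rmorphMn rmorph1.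
apply/selfadjointP; split; first exact/bounded_Z/bounded_D.
by move=> x y; rewrite !opE !ripE rP rQ.
Qed.

Lemma rip_mixture x : rip (X x) x = alpha * nrm (M x) ^+ 2 + (1 - alpha) * nrm (Q x) ^+ 2.
Proof.
have [_ rM] := (selfadjointP _).1 mean_selfadjoint; have [sQ _ _] := opabs_adjointP bA.
have [_ rQ] := (selfadjointP _).1 sQ.
by rewrite /X !opE !ripE rM rQ -!nrm_sqr.
Qed.

Lemma mixture_selfadjoint : selfadjoint X.
Proof.
have [bM rM] := (selfadjointP _).1 mean_selfadjoint; have [sQ _ _] := opabs_adjointP bA.
have [bQ rQ] := (selfadjointP _).1 sQ.
apply/selfadjointP; split.
  by apply: bounded_D; apply: bounded_Z; exact: bounded_comp.
by move=> x y; rewrite /X !opE !ripE !rM !rQ.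
Qed.

Lemma mixture_rpos : rpos X.
Proof.
move=> x; rewrite rip_mixture; case/andP: alpha01 => a0 a1.
by apply: addr_ge0; apply: mulr_ge0; rewrite ?sqr_ge0 ?subr_ge0.
Qed.

Lemma sqr_inner_le_mixture x : nrm x = 1 ->
  complex.Re `|inner (A x) x| ^+ 2 <= rip (X x) x.
Proof.
move=> x1; rewrite rip_mixture; case/andP: alpha01 => a0 a1.
set r := complex.Re _.
have r0 : 0 <= r by rewrite -ler0c RRe_real ?normr_real// normr_ge0.
have h1 : r ^+ 2 <= nrm (M x) ^+ 2.
  rewrite ler_sqr ?nnegrE ?nrm_ge0//; apply: le_trans (inner_le_mean x) _.
  apply: le_trans (ler_norm _) _; apply: le_trans (rip_le _ _) _.
  by rewrite x1 mulr1.
have h2 : r ^+ 2 <= nrm (Q x) ^+ 2.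
  by rewrite ler_sqr ?nnegrE ?nrm_ge0//; exact: inner_le_opabs_adjoint.
have a1' : 0 <= 1 - alpha by lra.
have := ler_wpM2l a0 h1; have := ler_wpM2l a1' h2; lra.
Qed.

(** Normalising a nonzero vector makes the set nonempty; a bound for [A] makes it bounded above. *)
Lemma has_sup_numerical_range : (exists x : H, x != 0) ->
  has_sup [set complex.Re `|inner (A x) x| | x in [set x : H | `|x| = 1]].
Proof.
move=> [x x0]; have [K K0 [hK _]] := bounded_rip bA.
split.
  pose y := (nrm x)^-1%:C *: x; exists (complex.Re `|inner (A y) y|), y => //=.
  rewrite nrmE /y nrmZ ger0_norm ?invr_ge0 ?nrm_ge0// mulVf ?nrm_eq0//.
exists K => _ [y /= y1 <-].
have y1' : nrm y = 1 by rewrite /nrm y1.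
have [z z1 zE] := inner_phase (A y) y; rewrite -[leLHS]zE.
apply: le_trans (ler_norm _) _; apply: le_trans (rip_le _ _) _.
rewrite nrmZc z1 mul1r y1' mulr1; apply: le_trans (hK y) _.
by rewrite y1' mulr1.
Qed.

End NumericalRadius.

(** * Lower and upper bounds for the norm of the integral *)

Theorem theorem3p9 (R : realType) (H : hilbertType R)
    (H_nonzero : exists x : H, x != 0)
    (A : H -> H) (A_bounded : bounded_operator A)
    (f : R -> R)
    (f_ge0 : forall x, 0 <= x -> 0 <= f x)
    (f_incr : forall x y, 0 <= x -> x <= y -> f x <= f y)
    (f_opconv : operator_convex (H := H) `[0, +oo[ f)
    (alpha : R) (alpha01 : 0 <= alpha <= 1) :
  let M : H -> H := 2^-1 *: (opabs A + opabs (adjoint A)) in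
  let X : H -> H := alpha%:C *: (M \o M)
    + (1 - alpha)%:C *: (opabs (adjoint A) \o opabs (adjoint A)) in
  let Y (t : R) : H -> H :=
    (1 - t)%:C *: X + (t * numradius A ^+ 2)%:C *: idfun in
  f (numradius A ^+ 2) <= opnorm (opint 0 1 (fun t => cfc f (Y t)))
    <= opnorm (cfc f X).
Proof.
pose M : H -> H := 2^-1 *: (opabs A + opabs (adjoint A)).
pose X : H -> H := alpha%:C *: (M \o M)
  + (1 - alpha)%:C *: (opabs (adjoint A) \o opabs (adjoint A)).
pose Y (t : R) : H -> H := (1 - t)%:C *: X + (t * numradius A ^+ 2)%:C *: idfun.
rewrite -[X in is_true X]/(f (numradius A ^+ 2)
  <= opnorm (opint 0 1 (fun t => cfc f (Y t))) <= opnorm (cfc f X)).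
have sX : selfadjoint X := mixture_selfadjoint A_bounded alpha.
have pX : rpos X := mixture_rpos A_bounded alpha01.
have hN := has_sup_numerical_range A_bounded H_nonzero.
have N0 r : [set complex.Re `|inner (A x) x| | x in [set x : H | `|x| = 1]] r -> 0 <= r.
  by move=> [x _ <-]; rewrite -ler0c RRe_real ?normr_real// normr_ge0.
pose c := numradius A ^+ 2; have c0 : 0 <= c := sqr_ge0 _.
have iF : is_opint 0 1 (fun t => cfc f (Y t)) (opint 0 1 (fun t => cfc f (Y t))).
  exact: segment_opint.
have bF t : bounded_operator (cfc f (Y t)) by exact: cfc_bounded.
(* The squared modulus of [inner (A x) x] is below both [rip (X x) x] and [c], hence below their
   convex combination; [f_incr] and [segment_jensen] do the rest. *)
have lower t x : 0 <= t <= 1 -> nrm x = 1 ->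
    f (complex.Re `|inner (A x) x| ^+ 2) <= rip (cfc f (Y t) x) x.
  move=> t01 x1; apply: le_trans (segment_jensen f_opconv f_incr sX pX c0 t01 x1).
  apply: f_incr; first exact: sqr_ge0.
  have h1 := sqr_inner_le_mixture A_bounded alpha01 x1; rewrite -/X in h1.
  set r := complex.Re _ in h1 *.
  have h2 : r ^+ 2 <= c.
    have Nr : [set complex.Re `|inner (A x) x| | x in [set x : H | `|x| = 1]] r.
      by exists x => //=; rewrite nrmE x1.
    have rw : r <= numradius A by exact: sup_ubound hN.2 _ Nr.
    by rewrite ler_sqr ?nnegrE ?(N0 r Nr) ?(le_trans (N0 r Nr) rw).
  case/andP: t01 => t0 t1; have t1' : 0 <= 1 - t by lra.
  have := ler_wpM2l t0 h2; have := ler_wpM2l t1' h1; lra.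
(* Used twice: with [B] the integral, and with [B] equal to [cfc f X]. *)
have le_opnorm B : bounded_operator B -> (forall x, nrm x = 1 ->
    f (complex.Re `|inner (A x) x| ^+ 2) <= rip (B x) x) -> f c <= opnorm B.
  move=> bB hB; apply: le_sup_sqr f_opconv.1 hN N0 _ => _ [x /= x1 <-].
  have nx : nrm x = 1 by rewrite /nrm x1.
  apply: le_trans (hB x nx) _; apply: le_trans (ler_norm _) _.
  apply: le_trans (rip_le _ _) _; rewrite nx mulr1 -[leRHS]mulr1 -nx.
  exact: nrm_le_opnorm.
apply/andP; split.
  apply: le_opnorm iF.1 _ => x x1.
  by apply: opint_rip_ge bF iF _ => t t01; exact: lower.
have fcX : f c <= opnorm (cfc f X).
  apply: le_opnorm (cfc_bounded f X) _ => x x1.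
  (* The endpoint [t = 0] gives the bound on [f c] that [segment_nrm_le] requires. *)
  have YX : Y 0 = X by rewrite /Y subr0 mul0r scale1r scale0r addr0.
  by have := lower 0 x _ x1; rewrite YX; apply; rewrite lexx ler01.
apply: opnorm_le; first exact/opnorm_ge0/cfc_bounded.
move=> v; apply: opint_nrm_le bF iF _ => t t01.
exact: segment_nrm_le.
Qed.
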